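(* Let $q:\mathbb R^{n+m}\to\mathbb R$ with $q\in\mathcal C^2(\mathbb R^{n+m};L_{2,q})$, let $(x,y)\in\mathbb R^n\times\mathbb R^m$, $\eta,\mu>0$, and let $u\sim\mathcal N(0,I_n)$, $v\sim\mathcal N(0,I_m)$ be independent. (a) For a given $\theta\in\mathbb R^n$, the stochastic Hessian block $$\tilde\nabla^2_{xx}q_{\eta,\mu}(x,y)=(uu^\top-I_n)\frac{q(x+\eta u,y+\mu v)+q(x-\eta u,y-\mu v)-2q(x,y)}{2\eta^2}$$ obeys $$\begin{aligned}\mathbb E_{u,v}\|\tilde\nabla^2_{xx}q_{\eta,\mu}(x,y)\theta\|^2\le\;&2L_{2,q}^2\Big(2\eta^2(n+16)^4+\frac{\mu^6}{\eta^4}(m+6)^3(n+3)\Big)\|\theta\|^2\\&+\Big(\frac{15}{2}(n+6)^2\|\nabla^2_{xx}q(x,y)\|_F^2+\frac{3\mu^2}{\eta^2}(3n+13)\|\nabla^2_{xy}q(x,y)\|_F^2\\&\qquad+\frac{3\mu^4}{2\eta^4}(m+2)(n+3)\|\nabla^2_{yy}q(x,y)\|_F^2\Big)\|\theta\|^2.\end{aligned}$$ (b) For a given $\theta\in\mathbb R^m$, the stochastic Hessian block $$\tilde\nabla^2_{xy}q_{\eta,\mu}(x,y)=uv^\top\frac{q(x+\eta u,y+\mu v)+q(x-\eta u,y-\mu v)-2q(x,y)}{\eta\mu}$$ obeys $$\begin{aligned}\mathbb E_{u,v}\|\tilde\nabla^2_{xy}q_{\eta,\mu}(x,y)\theta\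|^2\le\;&8L_{2,q}^2\Big[\frac{\eta^4}{\mu^2}(n+8)^4+\frac{2\mu^4}{\eta^2}n(m+12)^3\Big]\|\theta\|^2\\&+\Big(\frac{6\eta^2}{\mu^2}(n+4)(n+2)\|\nabla^2_{xx}q(x,y)\|_F^2+36(n+2)\|\nabla^2_{xy}q(x,y)\|_F^2\\&\qquad+\frac{30\mu^2}{\eta^2}n(m+2)\|\nabla^2_{yy}q(x,y)\|_F^2\Big)\|\theta\|^2.\end{aligned}$$
   Context: $m,n\ge1$. $\mathcal C^2(S;L_{2,q})$ is the class of twice differentiable functions whose Hessian is Lipschitz on $S$ (operator norm) with constant $L_{2,q}$. $\|\cdot\|$ is the Euclidean norm and $\|\cdot\|_F$ the Frobenius norm. $\nabla^2_{xx}q,\nabla^2_{xy}q,\nabla^2_{yy}q$ are the $n\times n$, $n\times m$, $m\times m$ blocks of $\nabla^2q$. *)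

(* Defs.v *)
From HB Require Import structures.
From mathcomp Require Export all_boot all_order all_algebra.
From mathcomp Require Export all_classical all_reals all_analysis.
Export Order.TTheory GRing.Theory Num.Theory.
Export numFieldNormedType.Exports.
Set Implicit Arguments.
Unset Strict Implicit.
Unset Printing Implicit Defensive.

Local Open Scope classical_set_scope.
Local Open Scope ring_scope.

(* The library norm on matrices is the sup norm of the entries. It is used only
   for the topology and for differentiability, which do not depend on the choice
   of the norm; every quantitative statement uses the three norms below. *)
Definition enorm (R : realType) (k : nat) (z : 'cV[R]_k) : R :=
  Num.sqrt (\sum_(i < k) z i 0 ^+ 2).

Definition opnorm (R : realType) (k l : nat) (A : 'M[R]_(k, l)) : R :=
  sup [set enorm (A *m z) | z in [set z : 'cV[R]_l | enorm z <= 1]].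

Definition frobenius_norm (R : realType) (k l : nat) (A : 'M[R]_(k, l)) : R :=
  Num.sqrt (\sum_(i < k) \sum_(j < l) A i j ^+ 2).

Definition gradient (R : realType) (k : nat) (f : 'cV[R]_k -> R)
    (z : 'cV[R]_k) : 'cV[R]_k :=
  \col_i 'D_(delta_mx i 0) f z.

Definition hessian (R : realType) (k : nat) (f : 'cV[R]_k -> R)
    (z : 'cV[R]_k) : 'M[R]_k :=
  \matrix_(i, j) 'D_(delta_mx i 0) ('D_(delta_mx j 0) f) z.

Definition twice_differentiable_at (R : realType) (k : nat)
    (f : 'cV[R]_k -> R) (z : 'cV[R]_k) : Prop :=
  (\forall z' \near z, differentiable f z') /\ differentiable (gradient f) z.

(* The class C^2(S; L). *)
Definition C2_lipschitz (R : realType) (k : nat) (S : set 'cV[R]_k) (L : R)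
    (f : 'cV[R]_k -> R) : Prop :=
  (forall z, S z -> twice_differentiable_at f z) /\
  (forall z z', S z -> S z' ->
     opnorm (hessian f z - hessian f z') <= L * enorm (z - z')).

Definition hessian_xx (R : realType) (n m : nat) (q : 'cV[R]_(n + m) -> R)
    (x : 'cV[R]_n) (y : 'cV[R]_m) : 'M[R]_n :=
  ulsubmx (hessian q (col_mx x y)).

Definition hessian_xy (R : realType) (n m : nat) (q : 'cV[R]_(n + m) -> R)
    (x : 'cV[R]_n) (y : 'cV[R]_m) : 'M[R]_(n, m) :=
  ursubmx (hessian q (col_mx x y)).

Definition hessian_yy (R : realType) (n m : nat) (q : 'cV[R]_(n + m) -> R)
    (x : 'cV[R]_n) (y : 'cV[R]_m) : 'M[R]_m :=
  drsubmx (hessian q (col_mx x y)).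

Definition second_difference (R : realType) (n m : nat)
    (q : 'cV[R]_(n + m) -> R) (eta mu : R) (x : 'cV[R]_n) (y : 'cV[R]_m)
    (u : 'cV[R]_n) (v : 'cV[R]_m) : R :=
  q (col_mx (x + eta *: u) (y + mu *: v))
  + q (col_mx (x - eta *: u) (y - mu *: v))
  - 2 * q (col_mx x y).

Definition stoch_hessian_xx (R : realType) (n m : nat)
    (q : 'cV[R]_(n + m) -> R) (eta mu : R) (x : 'cV[R]_n) (y : 'cV[R]_m)
    (u : 'cV[R]_n) (v : 'cV[R]_m) : 'M[R]_n :=
  (second_difference q eta mu x y u v / (2 * eta ^+ 2))
    *: (u *m u^T - 1%:M).

Definition stoch_hessian_xy (R : realType) (n m : nat)
    (q : 'cV[R]_(n + m) -> R) (eta mu : R) (x : 'cV[R]_n) (y : 'cV[R]_m)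
    (u : 'cV[R]_n) (v : 'cV[R]_m) : 'M[R]_(n, m) :=
  (second_difference q eta mu x y u v / (eta * mu)) *: (u *m v^T).

(* R^k with its Borel sigma-algebra; convertible to 'cV[R]_k. *)
Definition borel_cV (R : realType) (k : nat) :=
  g_sigma_algebraType (@open 'cV[R]_k).

Definition mutually_independent (d d' : measure_display)
    (T : measurableType d) (T' : measurableType d') (R : realType)
    (P : probability T R) (I : finType) (X : I -> T -> T') : Prop :=
  forall (J : {set I}) (B : I -> set T'),
    (forall i, i \in J -> measurable (B i)) ->
    P (\bigcap_(i in [set` J]) (X i @^-1` B i)) =
    (\prod_(i in J) P (X i @^-1` B i))%E.

Definition independent_pair (d d1 d2 : measure_display)
    (T : measurableType d) (T1 : measurableType d1) (T2 : measurableType d2)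
    (R : realType) (P : probability T R) (X : T -> T1) (Y : T -> T2) : Prop :=
  forall (A : set T1) (B : set T2), measurable A -> measurable B ->
    P ((X @^-1` A) `&` (Y @^-1` B)) = (P (X @^-1` A) * P (Y @^-1` B))%E.

Definition coordinate (R : realType) (T : Type) (k : nat)
    (u : T -> 'cV[R]_k) (i : 'I_k) : T -> R :=
  fun w => u w i 0.

(* u ~ N(0, I_k): the coordinates are independent standard normal variables.
   The laws are compared on measurable sets only, because P is an arbitrary
   function on the other ones. *)
Definition standard_gaussian (d : measure_display) (T : measurableType d)
    (R : realType) (P : probability T R) (k : nat)
    (u : {RV P >-> borel_cV R k}) : Prop :=
  mutually_independent P (coordinate u) /\
  (forall (i : 'I_k) (B : set R), measurable B ->
     P (coordinate u i @^-1` B) = normal_prob 0 1 B).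

(* Main.v *)
Require Import Defs.
From HB Require Import structures.
From mathcomp Require Import measurable_realfun ring lra.

(** Let z = (x, y), h = (eta u, mu v), and let A, B, C be the xx, xy and yy
    blocks of the Hessian at z.  Both parts bound the mean of D^2 times a weight,
    where D = q (z + h) + q (z - h) - 2 q z: with theta fixed, the squared norm
    of the stochastic block applied to theta is D^2 / (4 eta^4) times
    |(u . theta) u - theta|^2 in (a), and D^2 / (eta mu)^2 times
    |u|^2 (v . theta)^2 in (b).

    Two integrations of the Lipschitz bound on the Hessian along the segment
    from z - h to z + h give |D - h^T H h| <= L |h|^3 / 3
    ([second_difference_hessian]).  The Hessian is symmetric, by the classical
    comparison of the two mean value expansions of a mixed second difference
    ([hessian_sym]), so h^T H h = eta^2 u^T A u + 2 eta mu u^T B v +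
    mu^2 v^T C v.  The Cauchy-Schwarz inequality with weights 1/6, 1/3, 1/6, 1/3
    then bounds D^2 by a polynomial in (u, v) ([sqr_second_difference_le]).
    Every constant of the statement is large enough for these weights.

    There remain Gaussian moments of polynomials of degree at most ten.  All of
    them come from Stein's identity E (u_i F) = E (d_i F) for polynomials F.
    Its base case, for monomials, is the recursion E g^(k+1) = k E g^(k-1) for a
    standard normal g ([normal_momentS], integration by parts) together with
    the product rule for independent variables ([mean_prod_signed]); the rule
    for products of polynomials follows from the Leibniz rule.  For F
    homogeneous of degree k in u, Euler's relation turns Stein's identity into
    E (|u|^2 F) = (n + k) E F ([mean_sqnorm]), which removes one by one the
    factors |u|^2 and |v|^2.  What is left is explicit, for example
    E (u^T A u)^2 = (tr A)^2 + 2 |A|_F^2, and (tr A)^2 <= n |A|_F^2 together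
    with |A theta| <= |A|_F |theta| gives the bounds ([mean_quad_sqr_le],
    [mean_lin2_quad_sqr_le], [mean_lin2_bilinear_sqr_le]). *)

Set Implicit Arguments.
Unset Strict Implicit.
Unset Printing Implicit Defensive.
Local Open Scope classical_set_scope.
Local Open Scope ring_scope.

(** * Change of variables through a density *)

Section density.
Local Open Scope ereal_scope.
Import HBNNSimple.

(** The hypothesis is the conclusion for indicators; simple functions and
    monotone convergence extend it to all nonnegative [f].  It is used twice: with
    [X] the identity it computes integrals against a law given by a density, and
    with [G] a product of functions of other variables it expresses independence
    of [X] from that product. *)
Lemma ge0_integral_density d1 d2 (T1 : measurableType d1)
    (T2 : measurableType d2) (R : realType) (mu : {measure set T1 -> \bar R})
    (nu : {measure set T2 -> \bar R}) (X : T1 -> T2) (G : T1 -> R) :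
  measurable_fun setT X -> measurable_fun setT G -> (forall x, 0 <= G x)%R ->
  (forall B, measurable B -> \int[mu]_(x in X @^-1` B) (G x)%:E = nu B) ->
  forall f : T2 -> \bar R, measurable_fun setT f -> (forall y, 0 <= f y) ->
  \int[mu]_x ((G x)%:E * f (X x)) = \int[nu]_y f y.
Proof.
move=> mX mG G0 GB f mf f0; pose h := nnsfun_approx measurableT mf.
have mXB B : measurable B -> measurable (X @^-1` B).
  by move=> mB; rewrite -[X in measurable X]setTI; exact: mX.
have mhX n : measurable_fun setT (fun x => (h n (X x))%:E).
  by apply/measurable_EFinP; apply: (measurableT_comp _ mX) => //; exact: measurable_funP.
have mGE : measurable_fun setT (fun x => (G x)%:E) by exact/measurable_EFinP.
have -> : \int[nu]_y f y = lim (\int[nu]_y (h n y)%:E @[n --> \oo]).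
  have fE x : f x = lim ((EFin \o h n) x @[n --> \oo]).
    by apply/esym/cvg_lim => //; exact: cvg_nnsfun_approx.
  under eq_integral => x _ do rewrite fE.
  apply: monotone_convergence => //.
  - by move=> n; apply/measurable_EFinP; exact/measurable_funP.
  - by move=> n x _ /=; rewrite lee_fin.
  - by move=> x _ a b ab; rewrite lee_fin; exact/lefP/nd_nnsfun_approx.
have -> : \int[mu]_x ((G x)%:E * f (X x)) =
    lim (\int[mu]_x ((G x)%:E * (h n (X x))%:E) @[n --> \oo]).
  have fE x : (G x)%:E * f (X x) =
      lim ((G x)%:E * (h n (X x))%:E @[n --> \oo]).
    apply/esym/cvg_lim => //; apply: cvgeZl => //.
    exact: cvg_nnsfun_approx.
  under eq_integral => x _ do rewrite fE.
  apply: monotone_convergence => //.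
  - by move=> n; apply: emeasurable_funM.
  - by move=> n x _ /=; rewrite mule_ge0// lee_fin.
  - move=> x _ a b ab; rewrite lee_wpmul2l ?lee_fin//.
    exact/lefP/nd_nnsfun_approx.
suff suf n : \int[mu]_x ((G x)%:E * (h n (X x))%:E) = \int[nu]_y (h n y)%:E.
  by under eq_fun do rewrite suf.
pose r y x := (y * \1_(h n @^-1` [set y]) x)%:E : \bar R.
have mr y : measurable_fun setT (r y).
  by apply/measurable_EFinP; exact: measurable_funM.
have r0 y x : 0 <= r y x by exact: nnfun_muleindic_ge0.
have hE x : (h n x)%:E = \sum_(y \in range (h n)) r y x.
  by rewrite (fimfunE (h n)) -fsumEFin.
under [RHS]eq_integral do rewrite hE.
rewrite ge0_integral_fsum//.
under [LHS]eq_integral => x _ do rewrite hE ge0_mule_fsumr//.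
rewrite ge0_integral_fsum//; last 2 first.
- move=> y; apply: emeasurable_funM => //; exact: (measurableT_comp (mr y) mX).
- by move=> y x _; rewrite mule_ge0// lee_fin.
apply: eq_fsbigr => y; rewrite inE => -[z _ hz].
have y0 : (0 <= y)%R by rewrite -hz.
have mhy : measurable (h n @^-1` [set y]) by exact: measurable_sfunP.
transitivity (\int[mu]_x (y%:E * ((G x)%:E * (\1_(h n @^-1` [set y]) (X x))%:E))).
  by apply: eq_integral => x _; rewrite /r EFinM muleCA.
rewrite ge0_integralZl//; last 2 first.
- apply: emeasurable_funM => //; apply/measurable_EFinP.
  by apply: (measurableT_comp _ mX); exact: measurable_indic.
- by move=> x _; rewrite mule_ge0// lee_fin.
under [RHS]eq_integral do rewrite /r EFinM.
rewrite ge0_integralZl//; last first.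
- by apply/measurable_EFinP; exact: measurable_indic.
congr *%E; rewrite integral_indic// setIT -GB// [RHS]integral_mkcond.
apply: eq_integral => x _; rewrite patchE indicE.
have -> : (x \in X @^-1` (h n @^-1` [set y])) = (X x \in h n @^-1` [set y]).
  by apply/idP/idP; rewrite !inE.
by case: (_ \in _); rewrite ?mule1 ?mule0.
Qed.

Lemma integral_density d1 d2 (T1 : measurableType d1)
    (T2 : measurableType d2) (R : realType) (mu : {measure set T1 -> \bar R})
    (nu : {measure set T2 -> \bar R}) (X : T1 -> T2) (G : T1 -> R) :
  measurable_fun setT X -> measurable_fun setT G -> (forall x, 0 <= G x)%R ->
  (forall B, measurable B -> \int[mu]_(x in X @^-1` B) (G x)%:E = nu B) ->
  forall f : T2 -> R, measurable_fun setT f ->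
  mu.-integrable setT (EFin \o (fun x => G x * f (X x))%R) ->
  nu.-integrable setT (EFin \o f) /\
  \int[nu]_y (f y)%:E = \int[mu]_x (G x * f (X x))%:E.
Proof.
move=> mX mG G0 GB f mf /integrableP[_ Gfoo].
have mfE : measurable_fun setT (EFin \o f) by exact/measurable_EFinP.
have dens := ge0_integral_density mX mG G0 GB.
split.
  apply/integrableP; split => //; rewrite -dens//; last first.
    exact: measurableT_comp.
  rewrite (eq_integral (fun x => `|(G x * f (X x))%:E|)%E)// => x _.
  by rewrite EFinM abseM /= (ger0_norm (G0 x)).
rewrite integralE [RHS]integralE; congr (_ - _).
- rewrite -dens//; last exact: measurable_funepos.
  apply: eq_integral => x _; rewrite !funeposE maxe_pMr ?lee_fin// mule0.
  by rewrite EFinM.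
- rewrite -dens//; last exact: measurable_funeneg.
  apply: eq_integral => x _; rewrite !funenegE maxe_pMr ?lee_fin// mule0.
  by rewrite EFinM muleN.
Qed.

End density.

(** * Moments of the standard normal law *)

Section moments.
Context {R : realType}.
Local Notation mu := (@lebesgue_measure R).
Local Notation phi := (@normal_pdf R 0 1).

Lemma expr_le_expR (k : nat) (y : R) : 0 <= y -> y ^+ k <= k`!%:R * expR y.
Proof.
move=> y0; case: k => [|k]; first by rewrite expr0 mul1r -expR0 ler_expR.
rewrite mulrC -ler_pdivrMr ?ltr0n ?fact_gt0//.
by apply: le_trans (expR_ge1Dxn k y0); rewrite lerDr ler01.
Qed.

Lemma normal_pdf01E (x : R) : phi x = normal_peak 1 * expR (- x ^+ 2 / 2).
Proof.
by rewrite normal_pdfE ?oner_neq0// /normal_fun subr0 expr1n -mulr_natr mul1r.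
Qed.

(** A power of [x] is absorbed by [expR (x ^+ 2 / 4)], and the remaining factor
    [expR (- x ^+ 2 / 4)] is the density of variance 2 up to a constant; this
    gives an integrable majorant without any new integral. *)
Lemma expr_normal_pdf_le (k : nat) :
  exists C : R, forall x, `|x ^+ k * phi x| <= C * normal_pdf 0 (Num.sqrt 2) x.
Proof.
have s0 : Num.sqrt 2 != 0 :> R by rewrite gt_eqF// sqrtr_gt0.
pose D : R := 1 + 4 ^+ k * k`!%:R.
have D0 : 0 <= D by rewrite addr_ge0// mulr_ge0// exprn_ge0.
have xD (x : R) : `|x| ^+ k <= D * expR (x ^+ 2 / 4).
  have x4 : 0 <= x ^+ 2 / 4 by rewrite divr_ge0// sqr_ge0.
  have e1 : 1 <= expR (x ^+ 2 / 4) by rewrite -[leLHS]expR0 ler_expR.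
  rewrite /D mulrDl mul1r; have [x1|x1] := lerP `|x| 1.
    apply: (@le_trans _ _ 1); first by rewrite exprn_ile1.
    by apply: (le_trans e1); rewrite lerDl mulr_ge0 ?expR_ge0 ?mulr_ge0 ?exprn_ge0.
  (* an even power of x is a power of x ^+ 2 *)
  apply: (@le_trans _ _ (`|x| ^+ (2 * k))).
    by rewrite ler_weXn2l ?ltW// leq_pmull.
  rewrite exprM real_normK ?num_real//.
  apply: (@le_trans _ _ (4 ^+ k * k`!%:R * expR (x ^+ 2 / 4))).
    rewrite {1}(_ : x ^+ 2 = 4 * (x ^+ 2 / 4)); last by field.
    by rewrite exprMn -mulrA ler_wpM2l ?exprn_ge0// expr_le_expR.
  by rewrite lerDr expR_ge0.
exists (D * normal_peak 1 / normal_peak (Num.sqrt 2)) => x.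
rewrite normrM normrX (ger0_norm (normal_pdf_ge0 _ _ _)).
rewrite normal_pdf01E normal_pdfE// /normal_fun subr0 sqr_sqrtr//.
rewrite [leRHS](_ : _ = D * normal_peak 1 * expR (- x ^+ 2 / (2 *+ 2))).
  2: by field; rewrite gt_eqF// normal_peak_gt0.
have := xD x; set a := expR (x ^+ 2 / 4) => xa.
have a0 : 0 < a by exact: expR_gt0.
have -> : expR (- x ^+ 2 / (2 *+ 2)) = a^-1 by rewrite -expRN; congr expR; field.
have -> : expR (- x ^+ 2 / 2) = a^-1 * a^-1.
  by rewrite -expRN -expRD; congr expR; field.
rewrite (_ : D * _ * _ = D * a * (normal_peak 1 * (a^-1 * a^-1))); last first.
  by field; rewrite gt_eqF.
by rewrite ler_wpM2r// !mulr_ge0 ?normal_peak_ge0// invr_ge0 ltW.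
Qed.

Lemma integrable_expr_normal_pdf (k : nat) :
  mu.-integrable setT (EFin \o (fun x => x ^+ k * phi x)).
Proof.
have [C HC] := expr_normal_pdf_le k.
apply: le_integrable (integrableZl measurableT C
    (@integrable_normal_pdf _ 0 (Num.sqrt 2))) => //.
- apply/measurable_EFinP; apply: measurable_funM; first exact: exprn_measurable.
  exact: measurable_normal_pdf.
- move=> x _; rewrite -EFinM !abse_EFin lee_fin (le_trans (HC x))//.
  exact: ler_norm.
Qed.

(** Over the interval from [- n] to [n] the derivative integrates to
    [h n - h (- n)], which is [O(1 / n)]; dominated convergence passes to the
    whole line. *)
Lemma integral_derive_eq0 (h dh : R -> R) (C : R) :
  (forall x : R, is_derive x 1 h (dh x)) -> continuous dh ->
  mu.-integrable setT (EFin \o dh) -> (forall x, `|x * h x| <= C) ->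
  (\int[mu]_x (dh x)%:E = 0)%E.
Proof.
move=> hdh cdh idh hC.
have C0 : 0 <= C by apply: le_trans (hC 0).
(* n.+1 keeps the interval nondegenerate, as the integral formula requires *)
pose I n := `[- n.+1%:R, n.+1%:R]%classic : set R.
pose f_ n := (EFin \o dh) \_ (I n).
have mdh : measurable_fun setT (EFin \o dh) by exact: (measurable_int mu).
have mI n : measurable (I n) by exact: measurable_itv.
have mf_ n : measurable_fun setT (f_ n).
  apply/(measurable_restrictT _ (mI n)).
  exact: (measurable_funS measurableT (@subsetT _ _) mdh).
have cf_ : {ae mu, forall x, setT x -> f_ ^~ x @ \oo --> (EFin \o dh) x}.
  apply/aeW => x _; apply: cvg_near_cst; near=> n.
  rewrite /f_ patchE mem_set// /I /= in_itv/= -ler_norml.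
  rewrite (@le_trans _ _ n%:R)// ?ler_nat//; near: n.
  exact: nbhs_infty_ger.
have lef_ : {ae mu, forall x n, setT x -> (`|f_ n x| <= `|(dh x)%:E|)%E}.
  apply/aeW => x n _; rewrite /f_ patchE; case: ifP => // _.
  by rewrite abse0.
have [_ _ /= lim] := @dominated_convergence _ _ _ mu _ measurableT _ _ _
  mf_ mdh cf_ (integrable_abse idh) lef_.
have fE n : (\int[mu]_x f_ n x)%E = (h n.+1%:R - h (- n.+1%:R))%:E.
  rewrite -integral_mkcond EFinB; apply: continuous_FTC2.
  - by rewrite gtrN// ltr0n.
  - exact: continuous_subspaceT.
  - have hc x : {for x, continuous h}.
      apply/differentiable_continuous/derivable1_diffP.
      by have [] := hdh x.
    split.
    + by move=> x _; have [] := hdh x.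
    + by apply: cvg_at_right_filter; exact: hc.
    + by apply: cvg_at_left_filter; exact: hc.
  - by move=> x _; rewrite derive1E; have [_ ->] := hdh x.
have lim0 : (h n.+1%:R - h (- n.+1%:R)) @[n --> \oo] --> 0.
  apply: norm_cvg0.
  have H : (C + C) * harmonic n @[n --> \oo] --> (C + C) * 0.
    by apply: cvgMr; exact: cvg_harmonic.
  rewrite mulr0 in H.
  apply: (squeeze_cvgr _ (cvg_cst 0) H); near=> n.
  rewrite normr_ge0/= (le_trans (ler_normB _ _))// mulrDl.
  have n0 : 0 < n.+1%:R :> R by rewrite ltr0n.
  rewrite lerD// ler_pdivlMr//.
    by have := hC n.+1%:R; rewrite normrM (gtr0_norm n0) mulrC.
  by have := hC (- n.+1%:R); rewrite normrM normrN (gtr0_norm n0) mulrC.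
have lim' : (\int[mu]_x f_ n x)%E @[n --> \oo] --> 0%E.
  by under eq_cvg do rewrite fE; apply: cvg_EFin lim0; exact: nearW.
exact: cvg_unique lim lim'.
Unshelve. all: by end_near. Qed.

Definition normal_moment (k : nat) : R := (\int[mu]_x (x ^+ k * phi x))%R.

(** The laws are compared as set functions, because [nu] and [normal_prob] are
    measures on two presentations of the Borel sigma-algebra of [R]. *)
Lemma integral_normal_law (nu : {measure set R -> \bar R}) (k : nat) :
  (forall B, measurable B -> nu B = normal_prob 0 1 B) ->
  nu.-integrable setT (EFin \o (fun x => x ^+ k)) /\
  (\int[nu]_x (x ^+ k)%:E)%E = (normal_moment k)%:E.
Proof.
move=> nuE; have i := integrable_expr_normal_pdf k.
have [] := @integral_density _ _ _ _ _ mu nu id phi _ _ _ _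
    (fun x => x ^+ k) (exprn_measurable k).
- by move=> _ B mB; rewrite setTI preimage_id.
- exact: measurable_normal_pdf.
- exact: normal_pdf_ge0.
- by move=> B mB; rewrite nuE.
- by under [EFin \o _]eq_fun do rewrite mulrC.
move=> inu ->; split=> //.
rewrite /normal_moment fineK; last exact: integrable_fin_num.
by apply: eq_integral => x _; rewrite mulrC.
Qed.

Lemma is_derive_normal_pdf (x : R) : is_derive x 1 phi (- (x * phi x)).
Proof.
have -> : phi = (fun x : R => normal_peak 1 * expR (- 2^-1 * x ^+ 2)).
  by apply/funext => y; rewrite normal_pdf01E; congr (_ * expR _); field.
by apply: is_derive_eq; rewrite /GRing.scale/=; field.
Qed.

(** Integration by parts for [x ^+ k * phi x].  The case [k = 0] says that the mean
    vanishes. *)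
Lemma normal_momentS k : normal_moment k.+1 = k%:R * normal_moment k.-1.
Proof.
pose dh (x : R) := k%:R * (x ^+ k.-1 * phi x) - x ^+ k.+1 * phi x.
have hdh (x : R) : is_derive x 1 (fun x => x ^+ k * phi x) (dh x).
  have d := is_derive_normal_pdf x.
  have e : is_derive x 1 (fun x : R => x ^+ k) (k%:R * x ^+ k.-1).
    have := is_deriveX k (is_derive_id x (1 : R)).
    by rewrite exprfctE /GRing.scale/= mulr1.
  apply: (is_derive_eq (is_deriveM e d)).
  rewrite /GRing.scale/= /dh exprS; ring.
have i1 := integrable_expr_normal_pdf k.-1.
have i2 := integrable_expr_normal_pdf k.+1.
have i3 : mu.-integrable setT (EFin \o (fun x => k%:R * (x ^+ k.-1 * phi x))).
  exact: (integrableZl measurableT k%:R i1).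
have [C HC] := expr_normal_pdf_le k.+1.
have : (\int[mu]_x (dh x)%:E = 0)%E.
  apply: (@integral_derive_eq0 _ _ (`|C| * normal_peak (Num.sqrt 2)) hdh).
  - have cm j : continuous (fun x : R => x ^+ j * phi x).
      move=> x; apply: cvgM; first exact: exprn_continuous.
      by apply: continuous_normal_pdf; rewrite oner_neq0.
    by move=> x; apply: cvgB; [apply: cvgMr; exact: cm|exact: cm].
  - exact: (integrableB measurableT i3 i2).
  - move=> x; rewrite mulrA -exprS.
    rewrite (le_trans (HC x))// (le_trans (ler_norm _))// normrM.
    rewrite (ger0_norm (normal_pdf_ge0 _ _ _)) ler_wpM2l// normal_pdf_ub//.
rewrite /normal_moment.
move=> /(congr1 fine); rewrite -/(Rintegral _ _ _) RintegralB// RintegralZl//.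
by move=> /subr0_eq.
Qed.

End moments.

(** * Real-valued expectations *)

Section mean.
Context d (T : measurableType d) (R : realType) (P : probability T R).
Implicit Types f g : T -> R.

Definition integ f := P.-integrable setT (EFin \o f).
Definition mean f : R := \int[P]_w f w.

Lemma integD f g : integ f -> integ g -> integ (fun w => f w + g w).
Proof. exact: integrableD. Qed.

Lemma integZ k f : integ f -> integ (fun w => k * f w).
Proof. exact: integrableZl. Qed.

Lemma integ_cst (k : R) : integ (fun=> k).
Proof. exact: finite_measure_integrable_cst. Qed.

Lemma integB f g : integ f -> integ g -> integ (fun w => f w - g w).
Proof. exact: integrableB. Qed.

Lemma meanD f g : integ f -> integ g ->
  mean (fun w => f w + g w) = mean f + mean g.
Proof. exact: RintegralD. Qed.

Lemma meanB f g : integ f -> integ g ->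
  mean (fun w => f w - g w) = mean f - mean g.
Proof. exact: RintegralB. Qed.

Lemma meanZ k f : integ f -> mean (fun w => k * f w) = k * mean f.
Proof. exact: RintegralZl. Qed.

Lemma mean_cst (k : R) : mean (fun=> k) = k.
Proof.
by rewrite /mean Rintegral_cst//= probability_setT mulr1.
Qed.

Lemma mean_ge0 f : (forall w, 0 <= f w) -> 0 <= mean f.
Proof. by move=> f0; apply: Rintegral_ge0. Qed.

Lemma integ_sum (J : Type) (s : seq J) (F : J -> T -> R) :
  (forall j, integ (F j)) -> integ (fun w => \sum_(j <- s) F j w).
Proof.
move=> iF; elim: s => [|j s ih].
  by under eq_fun do rewrite big_nil; exact: integ_cst.
by under eq_fun do rewrite big_cons; exact: integD.
Qed.

Lemma mean_sum (J : Type) (s : seq J) (F : J -> T -> R) :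
  (forall j, integ (F j)) ->
  mean (fun w => \sum_(j <- s) F j w) = \sum_(j <- s) mean (F j).
Proof.
move=> iF; elim: s => [|j s ih].
  by under eq_fun do rewrite big_nil; rewrite big_nil mean_cst.
under eq_fun do rewrite big_cons.
by rewrite big_cons meanD// ?ih//; exact: integ_sum.
Qed.

Lemma integ_ge0 f : measurable_fun setT f -> (forall w, 0 <= f w) ->
  (\int[P]_w (f w)%:E < +oo)%E -> integ f.
Proof.
move=> mf f0 foo; apply/integrableP; split; first exact/measurable_EFinP.
by under eq_integral => w _ do rewrite /= ger0_norm//.
Qed.

Lemma mean_EFin f : integ f -> (\int[P]_w (f w)%:E = (mean f)%:E)%E.
Proof. by move=> iF; rewrite fineK//; exact: integrable_fin_num. Qed.

Lemma integ_measurable f : integ f -> measurable_fun setT f.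
Proof. by move=> /measurable_int/measurable_EFinP. Qed.

End mean.

(** * Expectation of a product of independent variables *)

Section independence.
Context d (T : measurableType d) (R : realType) (P : probability T R).
Variables (I : finType) (X : I -> {mfun T >-> R}).
Hypothesis indep : forall B : I -> set R, (forall i, measurable (B i)) ->
  P (\bigcap_(i in setT) (X i @^-1` B i)) = (\prod_i P (X i @^-1` B i))%E.

Definition mean_prod (f : I -> R -> R) :=
  integ P (fun w => \prod_i f i (X i w)) /\
  mean P (fun w => \prod_i f i (X i w)) = \prod_i mean P (fun w => f i (X i w)).

Definition replace (f : I -> R -> R) i g j := if j == i then g else f j.

Lemma prod_replace f i g (x : I -> R) :
  \prod_j replace f i g j (x j) = g (x i) * \prod_(j | j != i) f j (x j).
Proof.
rewrite (bigD1 i)//= /replace eqxx; congr (_ * _).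
by apply: eq_bigr => j /negbTE ->.
Qed.

Lemma prod_mean_replace f i g :
  \prod_j mean P (fun w => replace f i g j (X j w)) =
  mean P (fun w => g (X i w)) * \prod_(j | j != i) mean P (fun w => f j (X j w)).
Proof.
rewrite (bigD1 i)//= /replace eqxx; congr (_ * _).
by apply: eq_bigr => j /negbTE ->.
Qed.

Lemma prod_indic (B : I -> set R) w :
  \prod_i \1_(B i) (X i w) = \1_(\bigcap_(i in setT) (X i @^-1` B i)) w :> R.
Proof.
have [wB|wB] := pselect ((\bigcap_(i in setT) (X i @^-1` B i)) w).
  rewrite [RHS]indicE mem_set// big1// => i _.
  by rewrite indicE mem_set//; exact: wB.
rewrite [RHS]indicE memNset//.
move/existsNP : wB => [i /not_implyP[_ iB]].
by rewrite (bigD1 i)//= indicE memNset// mul0r.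
Qed.

Lemma indic_preimage i (B : set R) :
  (fun w => \1_B (X i w)) = \1_(X i @^-1` B) :> (T -> R).
Proof. by apply/funext => w; rewrite !indicE. Qed.

Let mX i : measurable_fun setT (X i).
Proof. exact: measurable_funP. Qed.

Let mXB i (B : set R) : measurable B -> measurable (X i @^-1` B).
Proof. by move=> mB; rewrite -[_ @^-1` _]setTI; exact: mX. Qed.

Lemma mean_indic (A : set T) : measurable A -> mean P \1_A = fine (P A).
Proof. by move=> mA; rewrite /mean /Rintegral integral_indic// setIT. Qed.

Lemma mean_prod_indic (B : I -> set R) : (forall i, measurable (B i)) ->
  mean_prod (fun i => \1_(B i)).
Proof.
move=> mB; have mBB : measurable (\bigcap_(i in setT) (X i @^-1` B i)).
  by apply: fin_bigcap_measurable => // i _; exact: mXB.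
rewrite /mean_prod.
have -> : (fun w => \prod_i \1_(B i) (X i w)) =
    (\1_(\bigcap_(i in setT) (X i @^-1` B i)) : T -> R).
  by apply/funext => w; rewrite prod_indic.
split; first by apply: integrable_indic => //; rewrite -ge0_fin_numE ?fin_num_measure.
rewrite mean_indic// indep//.
under [RHS]eq_bigr => i _.
  rewrite indic_preimage mean_indic; last exact: mXB.
  over.
suff -> : (\prod_i P (X i @^-1` B i) = (\prod_i fine (P (X i @^-1` B i)))%:E)%E.
  by [].
elim/big_rec2 : _ => // i y1 y2 _ ->.
by rewrite EFinM fineK ?fin_num_measure//; exact: mXB.
Qed.

(** Indicators are replaced by general nonnegative functions one coordinate at a
    time: [s] lists the coordinates already freed.  If the rule holds with an
    arbitrary indicator at [i], then the product [G] of the other factors satisfies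
    the hypothesis of [ge0_integral_density] for the law of [X i] scaled by the
    product [c] of the other means. *)
Lemma mean_prod_ge0 (s : seq I) (f : I -> R -> R) :
  (forall i, measurable_fun setT (f i)) -> (forall i x, 0 <= f i x) ->
  (forall i, integ P (fun w => f i (X i w))) ->
  (forall i, i \notin s -> exists2 B : set R, measurable B & f i = \1_B) ->
  mean_prod f.
Proof.
elim: s f => [|i s ih] f mf f0 intf fs.
  have /choice[B HB] (i : I) : exists B : set R, measurable B /\ f i = \1_B.
    by have [//|B mB fB] := fs i; exists B.
  have -> : f = (fun i => \1_(B i)) by apply/funext => i; have [_ ->] := HB i.
  by apply: mean_prod_indic => i; have [] := HB i.
pose G w := \prod_(j | j != i) f j (X j w).
pose c := \prod_(j | j != i) mean P (fun w => f j (X j w)).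
have c0 : 0 <= c by apply: prodr_ge0 => j _; exact: mean_ge0.
have G0 w : 0 <= G w by exact: prodr_ge0.
have mfX j : measurable_fun setT (fun w => f j (X j w)).
  exact: (integ_measurable (intf j)).
have mG : measurable_fun setT G.
  rewrite /G; under eq_fun do rewrite -big_filter.
  by apply: measurable_prod => j _.
have HB B : measurable B -> (\int[P]_(w in X i @^-1` B) (G w)%:E =
    mscale (NngNum c0) (distribution P (X i)) B)%E.
  move=> mB; rewrite /mscale/= /pushforward.
  have mXiB := mXB i mB.
  have iB : integ P (fun w => \1_B (X i w)).
    rewrite indic_preimage.
    by apply: integrable_indic => //; rewrite -ge0_fin_numE ?fin_num_measure.
  have [||||iint] := ih (replace f i \1_B).
  - by move=> j; rewrite /replace; case: ifP.
  - by move=> j x; rewrite /replace; case: ifP.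
  - by move=> j; rewrite /replace; case: ifPn => // /eqP ->.
  - move=> j js; rewrite /replace; case: ifPn => [_|ji]; first by exists B.
    by apply: fs; rewrite inE negb_or ji.
  rewrite prod_mean_replace -/c => E1.
  have E2 : (fun w => \prod_j replace f i \1_B j (X j w)) =
      (fun w => \1_B (X i w) * G w).
    by apply/funext => w; rewrite prod_replace.
  rewrite E2 in iint E1.
  rewrite integral_mkcond.
  transitivity (\int[P]_w (\1_B (X i w) * G w)%:E)%E.
    apply: eq_integral => w _; rewrite patchE indicE.
    have -> : (w \in X i @^-1` B) = (X i w \in B).
      by apply/idP/idP; rewrite !inE.
    by case: ifP; rewrite ?mul1r ?mul0r.
  rewrite mean_EFin// E1 EFinM muleC; congr (_ * _)%E.
  rewrite indic_preimage.
  by rewrite mean_indic// fineK// fin_num_measure.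
have mfE : measurable_fun setT (EFin \o f i) by exact/measurable_EFinP.
have f0E y : (0 <= (f i y)%:E)%E by rewrite lee_fin.
have := ge0_integral_density (mX i) mG G0 HB mfE f0E.
rewrite ge0_integral_mscale//= ge0_integral_distribution//=.
rewrite (mean_EFin (intf i)) -EFinM => E1.
have E2 : (fun w => \prod_j f j (X j w)) = (fun w => G w * f i (X i w)).
  by apply/funext => w; rewrite (bigD1 i)//= mulrC.
rewrite /mean_prod E2; split.
  apply: integ_ge0.
  - by apply: measurable_funM.
  - by move=> w; rewrite mulr_ge0.
  - by under eq_integral do rewrite EFinM; rewrite E1 ltry.
rewrite /mean /Rintegral; under eq_integral do rewrite EFinM.
by rewrite E1/= (bigD1 i)//= mulrC.
Qed.

(** Positive and negative parts are split one coordinate at a time, both sides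
    being linear in each factor; [s] lists the coordinates where a sign is
    allowed. *)
Lemma mean_prod_signed (s : seq I) (f : I -> R -> R) :
  (forall i, measurable_fun setT (f i)) ->
  (forall i, integ P (fun w => f i (X i w))) ->
  (forall i, i \notin s -> forall x, 0 <= f i x) ->
  mean_prod f.
Proof.
elim: s f => [|i s ih] f mf intf fs.
  by apply: (@mean_prod_ge0 (enum I)) => // [i x|i]; [exact: fs|rewrite mem_enum].
have mfX j : measurable_fun setT (fun w => f j (X j w)).
  exact: (integ_measurable (intf j)).
pose G w := \prod_(j | j != i) f j (X j w).
pose c := \prod_(j | j != i) mean P (fun w => f j (X j w)).
have part (g : R -> R) : measurable_fun setT g -> (forall x, 0 <= g x) ->
    (forall x, g x <= `|f i x|) ->
    integ P (fun w => g (X i w)) /\ (integ P (fun w => g (X i w) * G w) /\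
    mean P (fun w => g (X i w) * G w) = mean P (fun w => g (X i w)) * c).
  move=> mg g0 gf; have ig : integ P (fun w => g (X i w)).
    apply: le_integrable (intf i) => //.
      by apply/measurable_EFinP; exact: measurableT_comp (mX i).
    by move=> w _; rewrite lee_fin (ger0_norm (g0 _)).
  split=> //; have [|||ip ep] := ih (replace f i g).
  - by move=> j; rewrite /replace; case: ifP.
  - by move=> j; rewrite /replace; case: ifPn => // /eqP ->.
  - move=> j js x; rewrite /replace; case: ifPn => // ji.
    by apply: fs; rewrite inE negb_or ji.
  rewrite prod_mean_replace in ep; move: ip ep.
  by under eq_fun do rewrite prod_replace.
have [|||ip [ipG ep]] := part (fun x => Num.max (f i x) 0).
- by apply: measurable_maxr.
- by move=> x; rewrite le_max lexx orbT.
- by move=> x; rewrite ge_max ler_norm/=.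
have [|||iN [iNG en]] := part (fun x => Num.max (- f i x) 0).
- by apply: measurable_maxr => //; exact: measurableT_comp.
- by move=> x; rewrite le_max lexx orbT.
- by move=> x; rewrite ge_max -normrN ler_norm/=.
have fE x : f i x = Num.max (f i x) 0 - Num.max (- f i x) 0.
  have [f0|f0] := leP 0 (f i x).
    by rewrite max_r ?oppr_le0// subr0.
  by rewrite max_l ?oppr_ge0 ?ltW// sub0r opprK.
have E2 : (fun w => \prod_j f j (X j w)) = (fun w =>
   Num.max (f i (X i w)) 0 * G w - Num.max (- f i (X i w)) 0 * G w).
  by apply/funext => w; rewrite (bigD1 i)//= {1}fE mulrBl.
rewrite /mean_prod E2 meanB//; split; first exact: integB.
rewrite ep en -mulrBl -meanB// (bigD1 i)//=; congr (mean _ _ * _).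
by apply/funext => w; rewrite -fE.
Qed.

End independence.

(** * Monomials in independent standard normal variables *)

Section gaussian_monomials.
Context d (T : measurableType d) (R : realType) (P : probability T R).

Lemma gaussian_expr (Y : {mfun T >-> R}) (k : nat) :
  (forall B : set R, measurable B -> P (Y @^-1` B) = normal_prob 0 1 B) ->
  integ P (fun w => Y w ^+ k) /\ mean P (fun w => Y w ^+ k) = normal_moment k.
Proof.
move=> lawY.
have mk : measurable_fun setT (EFin \o (fun x : R => x ^+ k)).
  by apply/measurable_EFinP; exact: exprn_measurable.
have [/integrableP[_ ik] ek] := @integral_normal_law _ (distribution P Y) k lawY.
have iY : integ P (fun w => Y w ^+ k).
  apply/integrableP; split.
    by apply: (measurableT_comp mk); exact: measurable_funP.
  move: ik; rewrite ge0_integral_distribution//.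
  exact: measurableT_comp.
split=> //; rewrite /mean /Rintegral.
by move: ek; rewrite integral_distribution// => /= ->.
Qed.

Lemma gaussian_monomial (I : finType) (X : I -> {mfun T >-> R}) :
  (forall B : I -> set R, (forall i, measurable (B i)) ->
    P (\bigcap_(i in setT) (X i @^-1` B i)) = (\prod_i P (X i @^-1` B i))%E) ->
  (forall i (B : set R), measurable B ->
    P (X i @^-1` B) = normal_prob 0 1 B) ->
  forall a : I -> nat, integ P (fun w => \prod_i X i w ^+ a i) /\
    mean P (fun w => \prod_i X i w ^+ a i) = \prod_i normal_moment (a i).
Proof.
move=> indep law a.
have [i e] : mean_prod P X (fun i x => x ^+ a i).
  apply: (mean_prod_signed indep (s := enum I)).
  - by move=> i; exact: exprn_measurable.
  - by move=> i; have [] := gaussian_expr (a i) (law i).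
  - by move=> i; rewrite mem_enum.
split=> //; rewrite e; apply: eq_bigr => j _.
by have [] := gaussian_expr (a j) (law j).
Qed.

End gaussian_monomials.

(** * Stein's identity for polynomials *)

Section stein.
Context d (T : measurableType d) (R : realType) (P : probability T R).
Variables (I : finType) (X : I -> T -> R).

Definition monomial (a : I -> nat) (w : T) : R := \prod_i X i w ^+ a i.

Hypothesis mono_moments : forall a, integ P (monomial a) /\
  mean P (monomial a) = \prod_i normal_moment (a i).

Definition incr (a : I -> nat) i j := (a j + (j == i))%N.
Definition decr (a : I -> nat) i j := (a j - (j == i))%N.

Lemma monomial_incr a i w : monomial (incr a i) w = X i w * monomial a w.
Proof.
rewrite /monomial (bigD1 i)//= [in RHS](bigD1 i)//= /incr eqxx addn1 exprS -mulrA.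
by congr (_ * (_ * _)); apply: eq_bigr => j /negbTE ->; rewrite addn0.
Qed.

(** Stein's identity for [F] with gradient [dF], required for [F] times every
    monomial so that it can be propagated through products.  Where the
    subtraction in [decr] truncates, the factor [(a i)%:R] is zero. *)
Definition stein_pair (F : T -> R) (dF : I -> T -> R) := forall a i,
  [/\ integ P (fun w => monomial a w * F w),
      integ P (fun w => monomial a w * dF i w) &
      mean P (fun w => monomial (incr a i) w * F w) =
        (a i)%:R * mean P (fun w => monomial (decr a i) w * F w) +
        mean P (fun w => monomial a w * dF i w)].

Lemma stein_pair1 : stein_pair (fun=> 1) (fun _ _ => 0).
Proof.
move=> a i.
have E1 b : (fun w => monomial b w * 1) = monomial b.
  by apply/funext => w; rewrite mulr1.
have E0 b : (fun w => monomial b w * 0) = (fun=> 0).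
  by apply/funext => w; rewrite mulr0.
rewrite !E1 E0; split; first by have [] := mono_moments a.
  exact: integ_cst.
have [_ ->] := mono_moments (incr a i); have [_ ->] := mono_moments (decr a i).
rewrite mean_cst addr0 (bigD1 i)//= [in RHS](bigD1 i)//= /incr /decr eqxx.
rewrite addn1 subn1 normal_momentS mulrA; congr (_ * _).
by apply: eq_bigr => j /negbTE ->; rewrite addn0 subn0.
Qed.

(** Two functions satisfying [stein_pair] need not have a product that does, but
    operators preserving [stein_pair] compose.  This is why polynomials are
    treated as multiplication operators, with the Leibniz rule built in. *)
Definition multiplier (F : T -> R) (dF : I -> T -> R) := forall G dG,
  stein_pair G dG ->
  stein_pair (fun w => F w * G w) (fun i w => dF i w * G w + F w * dG i w).

Lemma multiplier_cst (c : R) : multiplier (fun=> c) (fun _ _ => 0).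
Proof.
move=> G dG GdG a i; have [i1 i2 e] := GdG a i.
have Ec b (H : T -> R) : (fun w => monomial b w * (c * H w)) =
    (fun w => c * (monomial b w * H w)).
  by apply/funext => w; rewrite mulrCA.
have Ed : (fun w => monomial a w * (0 * G w + c * dG i w)) =
    (fun w => c * (monomial a w * dG i w)).
  by apply/funext => w; rewrite mul0r add0r mulrCA.
have [i3 _ _] := GdG (incr a i) i; have [i4 _ _] := GdG (decr a i) i.
rewrite !Ec Ed; split; [exact: integZ|exact: integZ|].
by rewrite !meanZ// e mulrDr mulrCA.
Qed.

(** Multiplying by a coordinate only shifts the exponents of the auxiliary
    monomial; the gradient term appears when the shifted exponent is that of the
    differentiated coordinate. *)
Lemma multiplier_coord j : multiplier (X j) (fun i _ => (i == j)%:R).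
Proof.
move=> G dG GdG a i.
have Ej b (H : T -> R) : (fun w => monomial b w * (X j w * H w)) =
    (fun w => monomial (incr b j) w * H w).
  by apply/funext => w; rewrite monomial_incr mulrA (mulrC (monomial b w)).
have [i1 i2 e] := GdG (incr a j) i; have [i3 _ _] := GdG a i.
have Ed : (fun w => monomial a w * ((i == j)%:R * G w + X j w * dG i w)) =
    (fun w => (i == j)%:R * (monomial a w * G w) + monomial (incr a j) w * dG i w).
  apply/funext => w; rewrite monomial_incr; ring.
rewrite !Ej Ed; split=> //.
  by apply: integD => //; exact: integZ.
rewrite meanD//; last exact: integZ.
rewrite meanZ// addrA.
have -> : incr (incr a i) j = incr (incr a j) i.
  by apply/funext => k; rewrite /incr addnAC.
rewrite e; congr (_ + _).
have [->|ij] := eqVneq i j.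
  rewrite mul1r {1}/incr eqxx natrD mulrDl mul1r.
  have -> : decr (incr a j) j = a.
    by apply/funext => k; rewrite /incr /decr addnK.
  congr (_ + _); have [->|aj] := posnP (a j); first by rewrite !mul0r.
  congr (_ * mean _ _); apply/funext => w; congr (monomial _ _ * _).
  apply/funext => k; rewrite /incr /decr.
  by have [->|] := eqVneq k j; rewrite ?subn0 ?addn0// subnK.
rewrite mul0r addr0 {1}/incr (negbTE ij) addn0; congr (_ * mean _ _).
apply/funext => w; congr (monomial _ _ * _).
apply/funext => k; rewrite /incr /decr.
have [->|kj] := eqVneq k j; last by rewrite !addn0.
by rewrite eq_sym (negbTE ij) !subn0.
Qed.

Lemma multiplierD F dF G dG : multiplier F dF -> multiplier G dG ->
  multiplier (fun w => F w + G w) (fun i w => dF i w + dG i w).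
Proof.
move=> mF mG H dH HdH a i.
have [i1 i2 e] := mF _ _ HdH a i; have [i1' i2' e'] := mG _ _ HdH a i.
have [i3 _ _] := mF _ _ HdH (incr a i) i; have [i4 _ _] := mF _ _ HdH (decr a i) i.
have [i3' _ _] := mG _ _ HdH (incr a i) i; have [i4' _ _] := mG _ _ HdH (decr a i) i.
have ED b : (fun w => monomial b w * ((F w + G w) * H w)) =
    (fun w => monomial b w * (F w * H w) + monomial b w * (G w * H w)).
  by apply/funext => w; rewrite mulrDl mulrDr.
have EdD : (fun w => monomial a w *
     ((dF i w + dG i w) * H w + (F w + G w) * dH i w)) =
   (fun w => monomial a w * (dF i w * H w + F w * dH i w) +
             monomial a w * (dG i w * H w + G w * dH i w)).
  apply/funext => w; ring.
rewrite !ED EdD; split; [exact: integD|exact: integD|].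
rewrite !meanD// e e'; ring.
Qed.

Lemma multiplierM F dF G dG : multiplier F dF -> multiplier G dG ->
  multiplier (fun w => F w * G w) (fun i w => G w * dF i w + F w * dG i w).
Proof.
move=> mF mG H dH HdH.
have := mF _ _ (mG _ _ HdH).
have -> : (fun w => F w * G w * H w) = (fun w => F w * (G w * H w)).
  by apply/funext => w; rewrite mulrA.
have <- // : (fun i w => dF i w * (G w * H w) +
   F w * (dG i w * H w + G w * dH i w)) =
   (fun i w => (G w * dF i w + F w * dG i w) * H w + F w * G w * dH i w).
apply/funext => i; apply/funext => w; ring.
Qed.

Lemma multiplier_stein F dF : multiplier F dF ->
  forall i, [/\ integ P F, integ P (dF i) &
    mean P (fun w => X i w * F w) = mean P (dF i)].
Proof.
move=> mF; have := mF _ _ stein_pair1.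
have m0 w : monomial (fun=> 0%N) w = 1.
  by rewrite /monomial big1.
have E0 (H : T -> R) : (fun w => monomial (fun=> 0%N) w * H w) = H.
  by apply/funext => w; rewrite m0 mul1r.
have -> : (fun w => F w * 1) = F by apply/funext => w; rewrite mulr1.
have -> : (fun i w => dF i w * 1 + F w * 0) = dF.
  by apply/funext => i; apply/funext => w; rewrite mulr1 mulr0 addr0.
move=> sF i; have [] := sF (fun=> 0%N) i.
rewrite !E0 mul0r add0r => iF iD e; split=> //.
rewrite -e; congr mean; apply/funext => w.
by rewrite monomial_incr m0 mulr1.
Qed.

End stein.

(** * Inner products and bihomogeneous polynomials *)

Lemma eq_ler (R : realType) (a b : R) : a = b -> a <= b.
Proof. by move=> ->. Qed.

Section dot.
Context {R : realType}.

Definition dot (k : nat) (a b : 'cV[R]_k) : R := \sum_i a i 0 * b i 0.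

Lemma dotC k (a b : 'cV[R]_k) : dot a b = dot b a.
Proof. by apply: eq_bigr => i _; rewrite mulrC. Qed.

Lemma dotDr k (a b c : 'cV[R]_k) : dot a (b + c) = dot a b + dot a c.
Proof. by rewrite -big_split; apply: eq_bigr => i _; rewrite mxE mulrDr. Qed.

Lemma dotZr k (a b : 'cV[R]_k) c : dot a (c *: b) = c * dot a b.
Proof. by rewrite mulr_sumr; apply: eq_bigr => i _; rewrite mxE mulrCA. Qed.

Lemma dot0r k (a : 'cV[R]_k) : dot a 0 = 0.
Proof. by rewrite /dot big1// => i _; rewrite mxE mulr0. Qed.

Lemma dotDl k (a b c : 'cV[R]_k) : dot (b + c) a = dot b a + dot c a.
Proof. by rewrite dotC dotDr !(dotC a). Qed.

Lemma dotZl k (a b : 'cV[R]_k) c : dot (c *: b) a = c * dot b a.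
Proof. by rewrite dotC dotZr dotC. Qed.

Lemma dot_deltar k (a : 'cV[R]_k) i : dot a (delta_mx i 0) = a i 0.
Proof.
rewrite /dot (bigD1 i)//= mxE !eqxx mulr1 big1 ?addr0// => j ji.
by rewrite mxE (negbTE ji) mulr0.
Qed.

Lemma dotE k (a b : 'cV[R]_k) : dot a b = (a^T *m b) 0 0.
Proof. by rewrite mxE; apply: eq_bigr => i _; rewrite mxE. Qed.

Lemma dot_mulmx k l (A : 'M[R]_(k, l)) a b : dot a (A *m b) = dot (A^T *m a) b.
Proof. by rewrite !dotE trmx_mul trmxK mulmxA. Qed.

Lemma dot_ge0 k (a : 'cV[R]_k) : 0 <= dot a a.
Proof. by apply: sumr_ge0 => i _; rewrite -expr2 sqr_ge0. Qed.

Lemma enormE k (a : 'cV[R]_k) : enorm a ^+ 2 = dot a a.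
Proof.
rewrite /enorm (_ : \sum_i _ = dot a a); first by rewrite sqr_sqrtr// dot_ge0.
by apply: eq_bigr => i _; rewrite expr2.
Qed.

End dot.

Section forms.
Context (T : Type) (R : realType).

(** [bihom u v d e F g h]: the random variable [F] is a polynomial in the entries of
    [u] and [v], homogeneous of degree [d] in [u] and [e] in [v], with gradients
    [g] in [u] and [h] in [v].  The derivation carries the gradients, so that no
    differentiation is ever performed.  The zero polynomial has every degree,
    which empty sums require. *)
Inductive bihom n m (u : T -> 'cV[R]_n) (v : T -> 'cV[R]_m) : nat -> nat ->
    (T -> R) -> (T -> 'cV[R]_n) -> (T -> 'cV[R]_m) -> Prop :=
| bihom_zero d e : bihom u v d e (fun=> 0) (fun=> 0) (fun=> 0)
| bihom_cst c : bihom u v 0 0 (fun=> c) (fun=> 0) (fun=> 0)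
| bihom_coordl i : bihom u v 1 0 (fun w => u w i 0) (fun=> delta_mx i 0) (fun=> 0)
| bihom_coordr i : bihom u v 0 1 (fun w => v w i 0) (fun=> 0) (fun=> delta_mx i 0)
| bihomD d e F g h F' g' h' : bihom u v d e F g h -> bihom u v d e F' g' h' ->
    bihom u v d e (fun w => F w + F' w) (fun w => g w + g' w)
      (fun w => h w + h' w)
| bihomM d e d' e' F g h F' g' h' : bihom u v d e F g h -> bihom u v d' e' F' g' h' ->
    bihom u v (d + d') (e + e') (fun w => F w * F' w)
      (fun w => F' w *: g w + F w *: g' w) (fun w => F' w *: h w + F w *: h' w).

Lemma bihom_swap n m (u : T -> 'cV[R]_n) (v : T -> 'cV[R]_m) d e F g h :
  bihom u v d e F g h -> bihom v u e d F h g.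
Proof.
elim=> *; [exact: bihom_zero|exact: bihom_cst|exact: bihom_coordr|
  exact: bihom_coordl|exact: bihomD|exact: bihomM].
Qed.

End forms.

Section forms1.
Context (T : Type) (R : realType) (n m : nat) (u : T -> 'cV[R]_n) (v : T -> 'cV[R]_m).
Local Notation bihom := (bihom u v).

Lemma bihom_eq d e F g h F' g' h' : bihom d e F g h ->
  F =1 F' -> g =1 g' -> h =1 h' -> bihom d e F' g' h'.
Proof. by move=> + /funext <- /funext <- /funext <-. Qed.

(** Euler's relation for homogeneous functions. *)
Lemma bihom_euler d e F g h : bihom d e F g h ->
  forall w, dot (u w) (g w) = d%:R * F w.
Proof.
elim=> {d e F g h}.
- by move=> d e w; rewrite dot0r mulr0.
- by move=> c w; rewrite dot0r mul0r.
- by move=> i w; rewrite dot_deltar mul1r.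
- by move=> i w; rewrite dot0r mul0r.
- by move=> d e F g h F' g' h' _ H _ H' w; rewrite dotDr H H' mulrDr.
- move=> d e d' e' F g h F' g' h' _ H _ H' w.
  rewrite dotDr !dotZr H H' natrD; ring.
Qed.

Lemma bihom_sum (J : Type) (s : seq J) d e F g h :
  (forall j, bihom d e (F j) (g j) (h j)) ->
  bihom d e (fun w => \sum_(j <- s) F j w) (fun w => \sum_(j <- s) g j w)
    (fun w => \sum_(j <- s) h j w).
Proof.
move=> H; elim: s => [|j s ih].
  by apply: bihom_eq (bihom_zero _ _ _ _) _ _ _ => w; rewrite big_nil.
by apply: bihom_eq (bihomD (H j) ih) _ _ _ => w; rewrite big_cons.
Qed.

Lemma bihomZ d e c F g h : bihom d e F g h ->
  bihom d e (fun w => c * F w) (fun w => c *: g w) (fun w => c *: h w).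
Proof.
move=> H; have := bihomM (bihom_cst u v c) H; rewrite !add0n => H'.
by apply: bihom_eq H' _ _ _ => w //; rewrite scaler0 add0r.
Qed.

Lemma sum_delta k (a : 'cV[R]_k) : \sum_i a i 0 *: delta_mx i 0 = a.
Proof.
rewrite [RHS]matrix_sum_delta; apply: eq_bigr => i _.
by rewrite big_ord1.
Qed.

Lemma bihom_dotl a : bihom 1 0 (fun w => dot a (u w)) (fun=> a) (fun=> 0).
Proof.
have H i := bihomZ (a i 0) (bihom_coordl u v i).
apply: bihom_eq (bihom_sum (index_enum _) H) _ _ _ => w //.
- by rewrite sum_delta.
- by rewrite big1// => i _; rewrite scaler0.
Qed.

End forms1.

Section forms2.
Context (T : Type) (R : realType) (n m : nat) (u : T -> 'cV[R]_n) (v : T -> 'cV[R]_m).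
Local Notation bihom := (bihom u v).

Lemma bihom_dotr a : bihom 0 1 (fun w => dot a (v w)) (fun=> 0) (fun=> a).
Proof. exact/bihom_swap/bihom_dotl. Qed.

Lemma bihom_quad (A : 'M[R]_n) : A^T = A ->
  bihom 2 0 (fun w => dot (u w) (A *m u w)) (fun w => 2 *: (A *m u w)) (fun=> 0).
Proof.
move=> sA.
have H i := bihomM (bihom_coordl u v i) (bihom_dotl u v (row i A)^T).
have rA i w : dot (row i A)^T (u w) = (A *m u w) i 0.
  by rewrite mxE; apply: eq_bigr => j _; rewrite !mxE.
apply: bihom_eq (bihom_sum (index_enum _) H) _ _ _ => w.
- by apply: eq_bigr => i _; rewrite rA.
- rewrite big_split/= scaler_nat mulr2n; congr (_ + _).
    by rewrite -[RHS]sum_delta; apply: eq_bigr => i _; rewrite rA.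
  apply/colP => j; rewrite summxE [RHS]mxE; apply: eq_bigr => i _.
  by rewrite !mxE -[in RHS]sA mxE mulrC.
- by rewrite big1// => i _; rewrite !scaler0 addr0.
Qed.

Lemma bihom_bilinear (B : 'M[R]_(n, m)) :
  bihom 1 1 (fun w => dot (u w) (B *m v w)) (fun w => B *m v w)
    (fun w => B^T *m u w).
Proof.
have H i := bihomM (bihom_coordl u v i) (bihom_dotr (row i B)^T).
have rB i w : dot (row i B)^T (v w) = (B *m v w) i 0.
  by rewrite mxE; apply: eq_bigr => j _; rewrite !mxE.
apply: bihom_eq (bihom_sum (index_enum _) H) _ _ _ => w.
- by apply: eq_bigr => i _; rewrite rB.
- under eq_bigr do rewrite scaler0 addr0 rB.
  by rewrite sum_delta.
- under eq_bigr do rewrite scaler0 add0r.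
  apply/colP => j; rewrite summxE [RHS]mxE; apply: eq_bigr => i _.
  by rewrite !mxE mulrC.
Qed.

Lemma bihom_sqnorm : bihom 2 0 (fun w => dot (u w) (u w)) (fun w => 2 *: u w) (fun=> 0).
Proof.
by apply: bihom_eq (bihom_quad (trmx1 _ _)) _ _ _ => w //; rewrite mul1mx.
Qed.

End forms2.

(** * Gaussian integration by parts for a pair of vectors *)

Section stein_identity.
Context d (T : measurableType d) (R : realType) (P : probability T R).

(** Only the gradient in [u] appears; exchanging [u] and [v] by [bihom_swap] gives
    the identity for [v]. *)
Definition stein_identity n m (u : T -> 'cV[R]_n) (v : T -> 'cV[R]_m) :=
  forall k l F g h, bihom u v k l F g h -> integ P F /\
    forall i, integ P (fun w => g w i 0) /\
      mean P (fun w => u w i 0 * F w) = mean P (fun w => g w i 0).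

Definition joint n m (u : T -> 'cV[R]_n) (v : T -> 'cV[R]_m)
    (k : 'I_n + 'I_m) (w : T) : R :=
  match k with inl i => u w i 0 | inr j => v w j 0 end.

Lemma bihom_multiplier n m (u : T -> 'cV[R]_n) (v : T -> 'cV[R]_m) k l F g h :
  bihom u v k l F g h -> multiplier P (joint u v) F (fun i w => joint g h i w).
Proof.
elim=> {k l F g h}.
- move=> k l; have := @multiplier_cst _ _ _ P _ (joint u v) 0.
  by congr multiplier; apply/funext => -[] i; apply/funext => w /=; rewrite mxE.
- move=> c; have := @multiplier_cst _ _ _ P _ (joint u v) c.
  by congr multiplier; apply/funext => -[] i; apply/funext => w /=; rewrite mxE.
- move=> i; have := @multiplier_coord _ _ _ P _ (joint u v) (inl i).
  congr multiplier; apply/funext => -[] j; apply/funext => w /=.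
    by rewrite mxE eqxx andbT.
  by rewrite mxE.
- move=> i; have := @multiplier_coord _ _ _ P _ (joint u v) (inr i).
  congr multiplier; apply/funext => -[] j; apply/funext => w /=.
    by rewrite mxE.
  by rewrite mxE eqxx andbT.
- move=> k l F g h F' g' h' _ mF _ mF'.
  have := multiplierD mF mF'; congr multiplier.
  by apply/funext => -[] j; apply/funext => w /=; rewrite mxE.
- move=> k l k' l' F g h F' g' h' _ mF _ mF'.
  have := multiplierM mF mF'; congr multiplier.
  by apply/funext => -[] j; apply/funext => w /=; rewrite !mxE.
Qed.

Lemma steinP n m (u : T -> 'cV[R]_n) (v : T -> 'cV[R]_m) : (0 < n)%N ->
  (forall a, integ P (monomial (joint u v) a) /\
    mean P (monomial (joint u v) a) = \prod_i normal_moment (a i)) ->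
  stein_identity u v.
Proof.
move=> n0 mono k l F g h /bihom_multiplier/(multiplier_stein mono) Fg.
split; first by have [] := Fg (inl (Ordinal n0)).
by move=> i; have [] := Fg (inl i).
Qed.

End stein_identity.

Section gaussian_moments.
Context d (T : measurableType d) (R : realType) (P : probability T R).
Context n m (u : T -> 'cV[R]_n) (v : T -> 'cV[R]_m).
Hypothesis Su : stein_identity P u v.
Local Notation E := (mean P).

Lemma bihom_integ k l F g h : bihom u v k l F g h -> integ P F.
Proof. by move=> /Su[]. Qed.

Lemma eq_mean (F G : T -> R) : F =1 G -> E F = E G.
Proof. by move=> /funext ->. Qed.

(** The divergence form of Stein's identity: E (u . F) = E (div F) for a polynomial
    vector field [F]. *)
Lemma mean_divergence k l (F : 'I_n -> T -> R) g h :
  (forall i, bihom u v k l (F i) (g i) (h i)) ->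
  integ P (fun w => \sum_i g i w i 0) /\
  E (fun w => \sum_i u w i 0 * F i w) = E (fun w => \sum_i g i w i 0).
Proof.
move=> H; have ig i : integ P (fun w => g i w i 0) by have [_ /(_ i)[]] := Su (H i).
split; first exact: integ_sum.
rewrite !mean_sum//; last first.
  by move=> i; apply: (bihom_integ (bihomM (bihom_coordl u v i) (H i))).
by apply: eq_bigr => i _; have [_ /(_ i)[]] := Su (H i).
Qed.

Lemma mean_dotl a k l F g h : bihom u v k l F g h ->
  E (fun w => dot a (u w) * F w) = E (fun w => dot a (g w)).
Proof.
move=> H; have [_] := mean_divergence (fun i => bihomZ (a i 0) H).
rewrite (_ : (fun w => \sum_i (a i 0 *: g w) i 0) = (fun w => dot a (g w))).
  move=> <-; apply: eq_mean => w; rewrite mulr_suml; apply: eq_bigr => i _.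
  by rewrite mulrCA mulrA.
by apply/funext => w; apply: eq_bigr => i _; rewrite mxE.
Qed.

Lemma mean_bilinear (B : 'M[R]_(n, m)) k l F g h : bihom u v k l F g h ->
  E (fun w => dot (u w) (B *m v w) * F w) = E (fun w => dot (B *m v w) (g w)).
Proof.
move=> H; have rB i w : dot (row i B)^T (v w) = (B *m v w) i 0.
  by rewrite mxE; apply: eq_bigr => j _; rewrite !mxE.
have [_] := mean_divergence (fun i => bihomM (bihom_dotr u v (row i B)^T) H).
rewrite (_ : (fun w => _) = (fun w => dot (u w) (B *m v w) * F w)); last first.
  by apply/funext => w; rewrite mulr_suml; apply: eq_bigr => i _; rewrite rB mulrA.
move=> ->; apply: eq_mean => w; apply: eq_bigr => i _.
by rewrite rB !mxE mulr0 add0r.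
Qed.

(** The field is [F] times [A u], of divergence [\tr A * F + (A u) . grad F]. *)
Lemma mean_quad (A : 'M[R]_n) k l F g h : bihom u v k l F g h ->
  E (fun w => dot (u w) (A *m u w) * F w) =
  \tr A * E F + E (fun w => dot (A *m u w) (g w)).
Proof.
move=> H; have rA i w : dot (row i A)^T (u w) = (A *m u w) i 0.
  by rewrite mxE; apply: eq_bigr => j _; rewrite !mxE.
have [ig] := mean_divergence (fun i => bihomM (bihom_dotl u v (row i A)^T) H).
have gE : (fun w => \sum_(i < n) (F w *: (row i A)^T +
    dot (row i A)^T (u w) *: g w) i 0) =
    (fun w => \tr A * F w + dot (A *m u w) (g w)).
  apply/funext => w; rewrite /mxtrace mulr_suml -big_split.
  apply: eq_bigr => i _; rewrite mxE; congr (_ + _).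
    by rewrite !mxE mulrC.
  by rewrite mxE rA.
rewrite gE in ig *.
rewrite (_ : (fun w => _) = (fun w => dot (u w) (A *m u w) * F w)); last first.
  by apply/funext => w; rewrite mulr_suml; apply: eq_bigr => i _; rewrite rA mulrA.
move=> ->; have iF := bihom_integ H.
have iZ := integZ (\tr A) iF.
have iD : integ P (fun w => dot (A *m u w) (g w)).
  have := integB ig iZ; congr (integ P).
  by apply/funext => w; rewrite addrC addKr.
by rewrite meanD// meanZ.
Qed.

(** [mean_quad] at the identity matrix, where Euler's relation makes the gradient
    term a multiple of [F]. *)
Lemma mean_sqnorm k l F g h : bihom u v k l F g h ->
  E (fun w => dot (u w) (u w) * F w) = (n + k)%:R * E F.
Proof.
move=> H; have := mean_quad 1%:M H; rewrite mxtrace1.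
under eq_fun do rewrite mul1mx.
move=> ->; under [X in _ + E X]eq_fun do rewrite mul1mx (bihom_euler H).
by rewrite meanZ ?(bihom_integ H)// natrD mulrDl.
Qed.

End gaussian_moments.

(** * Frobenius norm inequalities *)

Section frobenius.
Context {R : realType}.

Definition sqfrob k l (A : 'M[R]_(k, l)) : R := \sum_i \sum_j A i j ^+ 2.

Lemma sqfrobE k l (A : 'M[R]_(k, l)) : frobenius_norm A ^+ 2 = sqfrob A.
Proof.
rewrite sqr_sqrtr// !sumr_ge0// => i _.
by rewrite sumr_ge0// => j _; rewrite sqr_ge0.
Qed.

Lemma sqfrob_ge0 k l (A : 'M[R]_(k, l)) : 0 <= sqfrob A.
Proof. by rewrite -sqfrobE sqr_ge0. Qed.

Lemma mxtrace_sqfrob k l (A : 'M[R]_(k, l)) : \tr (A^T *m A) = sqfrob A.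
Proof.
rewrite /sqfrob exchange_big; apply: eq_bigr => j _; rewrite mxE.
by apply: eq_bigr => i _; rewrite mxE expr2.
Qed.

Lemma sqfrob_tr k l (A : 'M[R]_(k, l)) : sqfrob A^T = sqfrob A.
Proof.
rewrite /sqfrob exchange_big; apply: eq_bigr => j _.
by apply: eq_bigr => i _; rewrite mxE.
Qed.

(** The squared norm of [(b . b) a - (a . b) b] equals
    [(b . b) ((a . a) (b . b) - (a . b)^2)]. *)
Lemma dot_cauchy_schwarz k (a b : 'cV[R]_k) : dot a b ^+ 2 <= dot a a * dot b b.
Proof.
have := dot_ge0 b; rewrite le_eqVlt => /orP[/eqP b0|b0].
  have bi i : b i 0 = 0.
    move: b0 => /esym/eqP; rewrite psumr_eq0 => [/allP/(_ i)|j _].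
      by rewrite mem_index_enum => /(_ isT)/eqP/eqP; rewrite mulf_eq0 orbb => /eqP.
    by rewrite -expr2 sqr_ge0.
  by rewrite -b0 mulr0 /dot big1 ?expr0n// => i _; rewrite bi mulr0.
have := dot_ge0 (dot b b *: a + (- dot a b) *: b).
rewrite dotDl !dotDr !dotZl !dotZr (dotC b a) => H.
have {}H : 0 <= dot b b * (dot a a * dot b b - dot a b ^+ 2).
  by apply: le_trans H _; apply: eq_ler; ring.
by rewrite -subr_ge0 -(pmulr_rge0 _ b0).
Qed.

Lemma sqr_mxtrace_le k (A : 'M[R]_k) : \tr A ^+ 2 <= k%:R * sqfrob A.
Proof.
pose a : 'cV[R]_k := \col_i A i i; pose o : 'cV[R]_k := \col__ 1.
have -> : \tr A = dot o a by apply: eq_bigr => i _; rewrite !mxE mul1r.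
apply: (le_trans (dot_cauchy_schwarz _ _)).
have -> : dot o o = k%:R.
  rewrite /dot; under eq_bigr do rewrite mxE mulr1.
  by rewrite sumr_const card_ord.
rewrite ler_wpM2l// ler_sum// => i _; rewrite mxE -expr2.
by rewrite (bigD1 i)//= lerDl sumr_ge0// => j _; rewrite sqr_ge0.
Qed.

Lemma dot_mulmx_le k l (A : 'M[R]_(k, l)) b :
  dot (A *m b) (A *m b) <= sqfrob A * dot b b.
Proof.
rewrite mulr_suml ler_sum// => i _; rewrite -expr2.
have -> : (A *m b) i 0 = dot (row i A)^T b.
  by rewrite mxE; apply: eq_bigr => j _; rewrite !mxE.
apply: (le_trans (dot_cauchy_schwarz _ _)).
rewrite ler_wpM2r ?dot_ge0//; apply: eq_ler.
by apply: eq_bigr => j _; rewrite !mxE expr2.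
Qed.

End frobenius.

(** * Moments of linear, quadratic and bilinear forms *)

Section moments.
Context d (T : measurableType d) (R : realType) (P : probability T R).
Context n m (u : T -> 'cV[R]_n) (v : T -> 'cV[R]_m).
Hypothesis Su : stein_identity P u v.
Local Notation E := (mean P).
Local Notation s a := (fun w => dot a (u w)).
Local Notation r := (fun w => dot (u w) (u w)).
Local Notation q A := (fun w => dot (u w) (A *m u w)).
Local Notation p B := (fun w => dot (u w) (B *m v w)).

Lemma mean_lin_lin a b : E (fun w => s a w * s b w) = dot a b.
Proof. by rewrite (mean_dotl Su a (bihom_dotl u v b)) mean_cst. Qed.

Lemma mean_quad1 (A : 'M[R]_n) : E (q A) = \tr A.
Proof.
have := mean_quad Su A (bihom_cst u v 1).
rewrite mean_cst mulr1 (_ : (fun=> dot _ 0) = fun=> 0); last first.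
  by apply/funext => w; rewrite dot0r.
rewrite mean_cst addr0 => <-; apply: eq_mean => w.
by rewrite mulr1.
Qed.

Lemma mean_dot_mulmx k (A : 'M[R]_(k, n)) :
  E (fun w => dot (A *m u w) (A *m u w)) = sqfrob A.
Proof.
rewrite -mxtrace_sqfrob -mean_quad1; apply: eq_mean => w.
by rewrite -mulmxA [RHS]dot_mulmx trmxK.
Qed.

Lemma mean_quad_sqr (A : 'M[R]_n) : A^T = A ->
  E (fun w => q A w * q A w) = \tr A ^+ 2 + 2 * sqfrob A.
Proof.
move=> sA; rewrite (mean_quad Su A (bihom_quad u v sA)) mean_quad1 expr2.
congr (_ + _); under eq_fun do rewrite dotZr.
rewrite meanZ ?mean_dot_mulmx//.
have := bihom_integ Su (bihom_quad u v (A := A *m A) _).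
rewrite trmx_mul sA => /(_ erefl); congr (integ P).
by apply/funext => w; rewrite -mulmxA dot_mulmx sA.
Qed.

Lemma mean_quad_sqr_le (A : 'M[R]_n) : A^T = A ->
  E (fun w => q A w * q A w) <= (n%:R + 2) * sqfrob A.
Proof. by move=> sA; rewrite mean_quad_sqr// (mulrDl n%:R) lerD2r sqr_mxtrace_le. Qed.

(** Two integrations by parts along [a]: the first removes one factor [a . u], the
    second removes the other from the mixed term [(a . u) (u^T A u) (a^T A u)]. *)
Lemma mean_lin2_quad_sqr a (A : 'M[R]_n) : A^T = A ->
  E (fun w => s a w * (s a w * (q A w * q A w))) =
  dot a a * (\tr A ^+ 2 + 2 * sqfrob A) +
  4 * (2 * dot (A *m a) (A *m a) + \tr A * dot a (A *m a)).
Proof.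
move=> sA; have bs b := bihom_dotl u v b; have bq := bihom_quad u v sA.
have bqq := bihomM bq bq; have iqq := bihom_integ Su bqq.
rewrite (mean_dotl Su a (bihomM (bs a) bqq)).
have bst := bihomM (bs a) (bihomM bq (bs (A *m a))).
have ist := bihom_integ Su bst.
rewrite (_ : (fun w => dot a _) = (fun w => dot a a * (q A w * q A w) +
    4 * (s a w * (q A w * s (A *m a) w)))); last first.
  apply/funext => w; rewrite !(dotDr, dotZr) (dot_mulmx _ a (u w)) sA; ring.
rewrite meanD ?meanZ//; try exact: integZ.
rewrite mean_quad_sqr//; congr (_ + 4 * _).
rewrite (mean_dotl Su a (bihomM bq (bs (A *m a)))).
have itt := bihom_integ Su (bihomM (bs (A *m a)) (bs (A *m a))).
have iq := bihom_integ Su bq.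
rewrite (_ : (fun w => dot a _) = (fun w => 2 * (s (A *m a) w * s (A *m a) w) +
    dot a (A *m a) * q A w)); last first.
  apply/funext => w; rewrite !(dotDr, dotZr) (dot_mulmx _ a (u w)) sA; ring.
rewrite meanD ?meanZ//; try exact: integZ.
by rewrite mean_lin_lin mean_quad1 (mulrC (\tr A)).
Qed.

(** In the exact value, 8 |A a|^2 <= 8 |A|_F^2 |a|^2 and
    (tr A)^2 <= n |A|_F^2, while 4 (tr A) (a^T A a) is at most
    2 |a|^2 (|A|_F^2 + (tr A)^2); the coefficients add up to [3 n + 12].  For
    [n = 1] this is the exact value 15. *)
Lemma mean_lin2_quad_sqr_le a (A : 'M[R]_n) : A^T = A ->
  E (fun w => s a w * (s a w * (q A w * q A w))) <=
  (3 * n%:R + 12) * sqfrob A * dot a a.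
Proof.
move=> sA; rewrite mean_lin2_quad_sqr//.
have := sqr_mxtrace_le A; have := dot_mulmx_le A a.
have := dot_cauchy_schwarz a (A *m a).
have := dot_ge0 a; have := sqfrob_ge0 A; have := dot_ge0 (A *m a).
move: (dot a (A *m a)) (dot (A *m a) (A *m a)) (dot a a) (\tr A) (sqfrob A) => x y N t f.
move=> y0 f0 N0 xy yf tf.
have xf : x ^+ 2 <= f * N ^+ 2.
  by rewrite (le_trans xy)// expr2 mulrA (mulrC _ N) ler_wpM2l.
have tx : 2 * (t * x) <= N * (f + t ^+ 2).
  have Z0 : 0 <= N * (f + t ^+ 2) by rewrite mulr_ge0// addr_ge0// sqr_ge0.
  apply: (le_trans (ler_norm _)).
  rewrite -(@ler_pXn2r _ 2)// ?nnegrE// real_normK ?num_real//.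
  have -> : (2 * (t * x)) ^+ 2 = 4 * t ^+ 2 * x ^+ 2 by ring.
  (* the difference of the two squares is a square *)
  apply: (@le_trans _ _ (4 * t ^+ 2 * (f * N ^+ 2))).
    by rewrite ler_wpM2l// mulr_ge0// sqr_ge0.
  rewrite -subr_ge0.
  have -> : (N * (f + t ^+ 2)) ^+ 2 - 4 * t ^+ 2 * (f * N ^+ 2) =
     (N * (f - t ^+ 2)) ^+ 2 by ring.
  exact: sqr_ge0.
have tN : N * t ^+ 2 <= N * (n%:R * f) by rewrite ler_wpM2l.
have -> : (3 * n%:R + 12) * f * N = 3 * (N * (n%:R * f)) + 12 * (f * N) by ring.
have -> : N * (t ^+ 2 + 2 * f) + 4 * (2 * y + t * x) =
  N * t ^+ 2 + 2 * (f * N) + 8 * y + 2 * (2 * (t * x)) by ring.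
have : N * (f + t ^+ 2) = f * N + N * t ^+ 2 by ring.
lra.
Qed.

(** A factor independent of [u] passes through the integration by parts. *)
Lemma mean_lin2 a k l F g h : bihom u v k l F g h -> (forall w, g w = 0) ->
  E (fun w => s a w * (s a w * F w)) = dot a a * E F.
Proof.
move=> bF g0; rewrite (mean_dotl Su a (bihomM (bihom_dotl u v a) bF)).
rewrite -meanZ ?(bihom_integ Su bF)//; apply: eq_mean => w.
by rewrite g0 scaler0 addr0 dotZr mulrC.
Qed.

Lemma mean_sqnorm_cube : E (fun w => r w * (r w * r w)) =
  (n%:R + 4) * ((n%:R + 2) * n%:R).
Proof.
have br := bihom_sqnorm u v.
rewrite (mean_sqnorm Su (bihomM br br)) (mean_sqnorm Su br).
have := mean_sqnorm Su (bihom_cst u v 1); rewrite addn0 mean_cst mulr1 => E1.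
rewrite (_ : E r = n%:R); first by rewrite !natrD; congr (_ * _); ring.
by rewrite -E1; apply: eq_mean => w; rewrite mulr1.
Qed.

Lemma mean_sqnorm_cube_mul k l F g h : bihom u v k l F g h ->
  E (fun w => r w * (r w * (r w * F w))) =
  (n%:R + (4 + k)%:R) * ((n%:R + (2 + k)%:R) * ((n%:R + k%:R) * E F)).
Proof.
move=> bF; have br := bihom_sqnorm u v.
rewrite (mean_sqnorm Su (bihomM br (bihomM br bF))).
by rewrite (mean_sqnorm Su (bihomM br bF)) (mean_sqnorm Su bF) !natrD.
Qed.

End moments.

Section moments2.
Context d (T : measurableType d) (R : realType) (P : probability T R).
Context n m (u : T -> 'cV[R]_n) (v : T -> 'cV[R]_m).
Hypotheses (Su : stein_identity P u v) (Sv : stein_identity P v u).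
Local Notation E := (mean P).
Local Notation s a := (fun w => dot a (u w)).
Local Notation r := (fun w => dot (u w) (u w)).
Local Notation q A := (fun w => dot (u w) (A *m u w)).
Local Notation p B := (fun w => dot (u w) (B *m v w)).

Lemma mean_bilinear_sqr (B : 'M[R]_(n, m)) :
  E (fun w => p B w * p B w) = sqfrob B.
Proof.
by rewrite (mean_bilinear Su B (bihom_bilinear u v B)) (mean_dot_mulmx Sv).
Qed.

Lemma mean_lin2_bilinear_sqr a (B : 'M[R]_(n, m)) :
  E (fun w => s a w * (s a w * (p B w * p B w))) =
  dot a a * sqfrob B + 2 * dot (B^T *m a) (B^T *m a).
Proof.
have bs := bihom_dotl u v a; have bp := bihom_bilinear u v B.
have bt := bihom_dotr u v (B^T *m a).
rewrite (mean_dotl Su a (bihomM bs (bihomM bp bp))).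
have ipp := bihom_integ Su (bihomM bp bp).
have ist := bihom_integ Su (bihomM bs (bihomM bp bt)).
rewrite (_ : (fun w => dot a _) = (fun w => dot a a * (p B w * p B w) +
    2 * (s a w * (p B w * dot (B^T *m a) (v w))))); last first.
  apply/funext => w; rewrite !(dotDr, dotZr) (dot_mulmx _ a (v w)); ring.
rewrite meanD ?meanZ//; try exact: integZ.
rewrite mean_bilinear_sqr (mean_dotl Su a (bihomM bp bt)); congr (_ + 2 * _).
rewrite -(mean_lin_lin Sv); apply: eq_mean => w.
by rewrite dotDr !dotZr dot0r mulr0 addr0 (dot_mulmx _ a (v w)).
Qed.

Lemma mean_lin2_bilinear_sqr_le a (B : 'M[R]_(n, m)) :
  E (fun w => s a w * (s a w * (p B w * p B w))) <= 3 * sqfrob B * dot a a.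
Proof.
rewrite mean_lin2_bilinear_sqr; have := dot_mulmx_le B^T a; rewrite sqfrob_tr.
have -> : 3 * sqfrob B * dot a a = dot a a * sqfrob B + 2 * (sqfrob B * dot a a).
  by ring.
lra.
Qed.

End moments2.

(** * Symmetric second differences in one variable *)

Section one_variable.
Context {R : realType}.

Lemma is_derive_continuous (f df : R -> R) :
  (forall t : R, is_derive t 1 f (df t)) -> continuous f.
Proof.
move=> fdf t; apply/differentiable_continuous/derivable1_diffP.
by have [] := fdf t.
Qed.

Lemma MVT_derive (f df : R -> R) (b : R) : 0 <= b ->
  (forall t : R, is_derive t 1 f (df t)) ->
  exists2 c, 0 <= c <= b & f b - f 0 = df c * b.
Proof.
move=> b0 fdf; have [c] := @MVT_segment _ f df 0 b b0 (fun x _ => fdf x)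
  (continuous_subspaceT (is_derive_continuous fdf)).
by rewrite in_itv/= subr0 => c0b e; exists c.
Qed.

Lemma le0_of_derive_le0 (f df : R -> R) :
  (forall t : R, is_derive t 1 f (df t)) -> f 0 = 0 ->
  (forall t, 0 <= t -> df t <= 0) -> forall t, 0 <= t -> f t <= 0.
Proof.
move=> fdf f0 df0 t t0; have [c /andP[c0 _]] := MVT_derive t0 fdf.
by rewrite f0 subr0 => ->; rewrite mulr_le0_ge0// df0.
Qed.

(** The function [g] is the symmetric second difference at [t] minus its expected
    value [f2 0 * t ^+ 2 + K / 3 * t ^+ 3].  It vanishes at 0 together with its
    derivative, and its second derivative is nonpositive on the positive
    half-line, so two monotonicity arguments give [g 1 <= 0]. *)
Lemma one_sided_second_difference_le (f f1 f2 : R -> R) (K : R) :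
  (forall t : R, is_derive t 1 f (f1 t)) ->
  (forall t : R, is_derive t 1 f1 (f2 t)) ->
  (forall t, f2 t - f2 0 <= K * `|t|) ->
  f 1 + f (- 1) - 2 * f 0 - f2 0 <= K / 3.
Proof.
move=> ff1 f12 f2K.
pose g1 t := f1 t - f1 (- t) - 2 * f2 0 * t - K * t ^+ 2.
pose g t := f t + f (- t) - 2 * f 0 - f2 0 * t ^+ 2 - K / 3 * t ^+ 3.
have opp (h dh : R -> R) : (forall t : R, is_derive t 1 h (dh t)) ->
    forall t : R, is_derive t 1 (fun t => h (- t)) (- dh (- t)).
  move=> hdh t; have hN := hdh (- t).
  have := @is_derive1_comp _ h -%R t (dh (- t)) (- 1) _ _.
  by rewrite mulrN1; apply.
have pow (c : R) k (t : R) : is_derive t 1 (fun t => c * t ^+ k.+1)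
    (c * k.+1%:R * t ^+ k).
  have := is_deriveX k.+1 (is_derive_id t (1 : R)).
  rewrite exprfctE => /(is_deriveZ c).
  by rewrite /GRing.scale/= mulr1 mulrA.
have gg1 (t : R) : is_derive t 1 g (g1 t).
  have d1 := ff1 t; have d2 := opp _ _ ff1 t.
  have d3 := pow (f2 0) 1%N t; have d4 := pow (K / 3) 2%N t.
  rewrite /g; by apply: is_derive_eq; rewrite /g1 expr1; field.
have g12 (t : R) : is_derive t 1 g1 (f2 t + f2 (- t) - 2 * f2 0 - 2 * K * t).
  have d1 := f12 t; have d2 := opp _ _ f12 t.
  have d3 := pow (2 * f2 0) 0%N t; have d4 := pow K 1%N t.
  rewrite /g1; apply: is_derive_eq; rewrite ?expr1; ring.
have g1le t : 0 <= t -> g1 t <= 0.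
  move=> t0; apply: (le0_of_derive_le0 g12) => // [|x x0].
    rewrite /g1 oppr0; ring.
  have := f2K x; have := f2K (- x); rewrite normrN (ger0_norm x0).
  lra.
have : g 1 <= 0.
  apply: (le0_of_derive_le0 gg1) => //.
  rewrite /g oppr0; ring.
rewrite /g !expr1n; lra.
Qed.

Lemma second_difference_norm_le (f f1 f2 : R -> R) (K : R) :
  (forall t : R, is_derive t 1 f (f1 t)) ->
  (forall t : R, is_derive t 1 f1 (f2 t)) ->
  (forall t, `|f2 t - f2 0| <= K * `|t|) ->
  `|f 1 + f (- 1) - 2 * f 0 - f2 0| <= K / 3.
Proof.
move=> ff1 f12 f2K; rewrite ler_norml; apply/andP; split.
  rewrite lerNl.
  have := @one_sided_second_difference_le (\- f) (\- f1) (\- f2) K.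
  have -> : - (f 1 + f (-1) - 2 * f 0 - f2 0) =
    (\- f) 1 + (\- f) (- 1) - 2 * (\- f) 0 - (\- f2) 0 by rewrite /=; ring.
  apply=> t.
  apply: le_trans (f2K t); rewrite -normrN opprB; apply: le_trans (ler_norm _).
  by rewrite /= opprK addrC.
apply: (one_sided_second_difference_le ff1 f12) => t.
exact: le_trans (ler_norm _) (f2K t).
Qed.

End one_variable.

(** * Euclidean and operator norms *)

Section operator_norm.
Context {R : realType}.

Lemma enorm_ge0 k (z : 'cV[R]_k) : 0 <= enorm z.
Proof. exact: sqrtr_ge0. Qed.

Lemma enorm_le k (z : 'cV[R]_k) c : 0 <= c -> (enorm z <= c) = (dot z z <= c ^+ 2).
Proof. by move=> c0; rewrite -enormE ler_pXn2r// nnegrE// enorm_ge0. Qed.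

Lemma enormZ k c (z : 'cV[R]_k) : enorm (c *: z) = `|c| * enorm z.
Proof.
apply/eqP; rewrite -(@eqrXn2 _ 2)// ?mulr_ge0 ?enorm_ge0//.
by rewrite exprMn real_normK ?num_real// !enormE dotZl dotZr mulrA expr2.
Qed.

Lemma dot_le_enorm k (a b : 'cV[R]_k) : `|dot a b| <= enorm a * enorm b.
Proof.
rewrite -(@ler_pXn2r _ 2)// ?nnegrE ?mulr_ge0 ?enorm_ge0//.
by rewrite real_normK ?num_real// exprMn !enormE dot_cauchy_schwarz.
Qed.

Lemma ler_enormD k (a b : 'cV[R]_k) : enorm (a + b) <= enorm a + enorm b.
Proof.
rewrite enorm_le ?addr_ge0 ?enorm_ge0// dotDl !dotDr sqrrD !enormE (dotC b a).
have := le_trans (ler_norm _) (dot_le_enorm a b).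
by rewrite mulr2n; lra.
Qed.

(** The supremum in [opnorm] is over a set bounded by the Frobenius norm, so it is
    an upper bound; the inequality then scales from the unit ball. *)
Lemma enorm_mulmx_le k l (A : 'M[R]_(k, l)) z :
  enorm (A *m z) <= opnorm A * enorm z.
Proof.
have ub : has_ubound [set enorm (A *m z) | z in [set z : 'cV[R]_l | enorm z <= 1]].
  exists (Num.sqrt (sqfrob A)) => _ [y /= y1 <-].
  rewrite enorm_le ?sqrtr_ge0// sqr_sqrtr ?sqfrob_ge0//.
  rewrite (le_trans (dot_mulmx_le _ _))// ler_piMr ?sqfrob_ge0//.
  by move: y1; rewrite enorm_le// expr1n.
have [z0|z0] := eqVneq (enorm z) 0.
  have -> : enorm (A *m z) = 0; last by rewrite z0 mulr0.
  apply/eqP; rewrite -sqrf_eq0 enormE eq_le dot_ge0 andbT.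
  by rewrite (le_trans (dot_mulmx_le _ _))// -enormE z0 expr0n mulr0.
have zp : 0 < enorm z by rewrite lt_def z0 enorm_ge0.
have -> : A *m z = enorm z *: (A *m ((enorm z)^-1 *: z)).
  by rewrite -scalemxAr scalerA divff// scale1r.
rewrite enormZ ger0_norm ?enorm_ge0// mulrC ler_wpM2r ?enorm_ge0//.
apply: ub_le_sup => //; exists ((enorm z)^-1 *: z) => //=.
by rewrite enormZ ger0_norm ?invr_ge0 ?enorm_ge0// mulVf.
Qed.

Lemma dot_mulmx_opnorm k l (A : 'M[R]_(k, l)) a b :
  `|dot a (A *m b)| <= opnorm A * (enorm a * enorm b).
Proof.
rewrite (le_trans (dot_le_enorm _ _))// mulrCA ler_wpM2l ?enorm_ge0//.
exact: enorm_mulmx_le.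
Qed.

End operator_norm.

(** * Restriction of a function of class C2 to lines *)

Section along_lines.
Context {R : realType}.

Lemma is_derive_line k (f : 'cV[R]_k -> R) z h (t : R) :
  differentiable f (z + t *: h) ->
  is_derive t 1 (fun t => f (z + t *: h)) (dot h (gradient f (z + t *: h))).
Proof.
move=> df; set a := z + t *: h.
have E : (fun s : R => s^-1 *: (((fun t => f (z + t *: h)) \o shift t) (s *: 1) -
      (fun t => f (z + t *: h)) t)) =
    (fun s : R => s^-1 *: ((f \o shift a) (s *: h) - f a)).
  apply/funext => s /=; congr (_ *: (f _ - _)).
  by rewrite /a -[s *: 1]/(s * 1) mulr1 scalerDl addrCA.
have dfh : derivable f a h by exact: diff_derivable.
split; first by rewrite /derivable E.
rewrite /derive E -/(derive f a h) deriveE//.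
rewrite -[h in LHS]sum_delta linear_sum; apply: eq_bigr => i _.
by rewrite linearZ /= mxE deriveE.
Qed.

End along_lines.

Section hessian.
Context {R : realType} (k : nat) (q : 'cV[R]_k -> R) (L : R).
Hypothesis hq : C2_lipschitz [set: 'cV[R]_k] L q.

Lemma C2_differentiable z : differentiable q z.
Proof. by have [/(_ z I)[/nbhs_singleton ? _] _] := hq. Qed.

Lemma gradient_coord_differentiable z i :
  differentiable (fun z => gradient q z i 0) z.
Proof.
have [/(_ z I)[_ dG] _] := hq.
exact: (differentiable_comp dG (differentiable_coord _ i 0)).
Qed.

Lemma gradient_coordE i : (fun z => gradient q z i 0) = 'D_(delta_mx i 0) q.
Proof. by apply/funext => z; rewrite mxE. Qed.

Lemma sum_dot_gradient b : (fun z => dot b (gradient q z)) =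
  \sum_i (b i 0 \*: 'D_(delta_mx i 0) q).
Proof.
apply/funext => y; rewrite fct_sumE; apply: eq_bigr => i _.
by rewrite -gradient_coordE.
Qed.

Lemma dot_gradient_differentiable z b :
  differentiable (fun z => dot b (gradient q z)) z.
Proof.
rewrite sum_dot_gradient; apply: differentiable_sum => i.
apply: differentiableZ; rewrite -gradient_coordE.
exact: gradient_coord_differentiable.
Qed.

Lemma is_derive_line_gradient z a b (t : R) :
  is_derive t 1 (fun t => dot b (gradient q (z + t *: a)))
    (dot a (hessian q (z + t *: a) *m b)).
Proof.
have := is_derive_line (dot_gradient_differentiable (z + t *: a) b).
congr is_derive; apply: eq_bigr => i _; congr (_ * _).
have dD j : derivable ('D_(delta_mx j 0) q) (z + t *: a) (delta_mx i 0).
  rewrite -gradient_coordE; apply: diff_derivable.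
  exact: gradient_coord_differentiable.
rewrite !mxE /= sum_dot_gradient derive_sum => [|j]; last exact: derivableZ.
by apply: eq_bigr => j _; rewrite mxE deriveZ//= mulrC.
Qed.

(** The mixed difference is [f s - f 0] with [f] the increment of [q] in the
    direction [b]; the mean value theorem is applied to [f] along [a], and then
    to the derivative of [q] along [a] in the direction [b]. *)
Lemma mixed_difference z a b s : 0 <= s -> exists p,
  enorm (p - z) <= s * (enorm a + enorm b) /\
  q (z + s *: a + s *: b) - q (z + s *: a) - q (z + s *: b) + q z =
  s ^+ 2 * dot b (hessian q p *m a).
Proof.
move=> s0.
pose f t := q (z + s *: b + t *: a) - q (z + t *: a).
pose df t := dot a (gradient q (z + s *: b + t *: a)) - dot a (gradient q (z + t *: a)).
have fdf (t : R) : is_derive t 1 f (df t).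
  apply: is_deriveB; apply: is_derive_line; exact: C2_differentiable.
have [c /andP[c0 cs] fE] := MVT_derive s0 fdf.
have gdg := is_derive_line_gradient (z + c *: a) b a.
have [c' /andP[c'0 c's] gE] := MVT_derive s0 gdg.
exists (z + c *: a + c' *: b); split.
  have -> : z + c *: a + c' *: b - z = c *: a + c' *: b.
    by apply/colP => i; rewrite !mxE; ring.
  rewrite (le_trans (ler_enormD _ _))// !enormZ !ger0_norm// mulrDr.
  by rewrite lerD// ler_wpM2r// enorm_ge0.
have -> : q (z + s *: a + s *: b) - q (z + s *: a) - q (z + s *: b) + q z =
   f s - f 0.
  by rewrite /f !scale0r !addr0 (addrAC z); ring.
rewrite fE /df expr2 -mulrA mulrC; congr (_ * _).
rewrite mulrC -gE scale0r addr0; congr (dot a (gradient q _) - _).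
exact: addrAC.
Qed.

Lemma hessian_lipschitz z p a b :
  `|dot b ((hessian q p - hessian q z) *m a)| <=
  L * enorm (p - z) * (enorm b * enorm a).
Proof.
apply: (le_trans (dot_mulmx_opnorm _ _ _)).
by rewrite ler_wpM2r ?mulr_ge0 ?enorm_ge0//; have [_ ->] := hq.
Qed.

(** The mixed difference is symmetric in [a] and [b], so its two mean value forms
    agree at points within [O(s)] of [z]; as the Hessian is Lipschitz, the two
    sides differ by [O(s)] for every [s > 0]. *)
Lemma dot_hessianC z a b : dot b (hessian q z *m a) = dot a (hessian q z *m b).
Proof.
pose C := `|L| * (enorm a + enorm b) * (enorm b * enorm a).
have C0 : 0 <= C by rewrite !mulr_ge0 ?addr_ge0 ?enorm_ge0.
have near a' b' s p t : 0 <= s -> enorm (p - z) <= s * (enorm a' + enorm b') ->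
    t = dot b' (hessian q p *m a') ->
    `|t - dot b' (hessian q z *m a')| <=
    s * (`|L| * (enorm a' + enorm b') * (enorm b' * enorm a')).
  move=> s0 pz ->; have := hessian_lipschitz z p a' b'.
  rewrite mulmxBl dotDr -scaleN1r dotZr mulN1r => /le_trans; apply.
  have -> : s * (`|L| * (enorm a' + enorm b') * (enorm b' * enorm a')) =
      `|L| * (s * (enorm a' + enorm b')) * (enorm b' * enorm a') by ring.
  rewrite ler_wpM2r ?mulr_ge0 ?enorm_ge0//.
  apply: le_trans (ler_wpM2l (normr_ge0 L) pz).
  by rewrite ler_wpM2r ?enorm_ge0 ?ler_norm.
have H s : 0 < s ->
    `|dot b (hessian q z *m a) - dot a (hessian q z *m b)| <= s * (2 * C).
  move=> s0; have s0' := ltW s0.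
  have [p [pz pE]] := mixed_difference z a b s0'.
  have [p' [pz' pE']] := mixed_difference z b a s0'.
  have pp : dot b (hessian q p *m a) = dot a (hessian q p' *m b).
    apply: (@mulfI _ (s ^+ 2)); first by rewrite expf_neq0// gt_eqF.
    apply: etrans (esym pE) _; apply: etrans pE'.
    by rewrite (addrAC z) -!addrA; congr (_ + _); rewrite addrCA.
  have H1 := near _ _ _ _ _ s0' pz erefl; have H2 := near _ _ _ _ _ s0' pz' pp.
  have E : s * (2 * C) = s * (`|L| * (enorm a + enorm b) * (enorm b * enorm a)) +
      s * (`|L| * (enorm b + enorm a) * (enorm a * enorm b)).
    rewrite /C; ring.
  rewrite E -(subrKA (dot b (hessian q p *m a))).
  by apply: (le_trans (ler_normD _ _)); rewrite distrC lerD.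
apply/eqP; rewrite -subr_eq0 -normr_le0; apply/ler_addgt0Pl => e e0.
rewrite addr0; have C1 : 0 < 2 * C + 1 by rewrite ltr_wpDl// mulr_ge0.
apply: (le_trans (H (e / (2 * C + 1)) _)); first exact: divr_gt0.
by rewrite mulrAC ler_pdivrMr// ler_wpM2l ?lerDl// ltW.
Qed.

Lemma hessian_sym z : (hessian q z)^T = hessian q z.
Proof.
apply/matrixP => i j; rewrite mxE.
have := dot_hessianC z (delta_mx i 0) (delta_mx j 0).
by rewrite !(dotC (delta_mx _ _)) !dot_deltar -!colE !mxE.
Qed.

(** Along the line through [z] directed by [h] the second derivative is
    [h^T H h], with Lipschitz constant [L |h|^3] in the parameter. *)
Lemma second_difference_hessian z h :
  `|q (z + h) + q (z - h) - 2 * q z - dot h (hessian q z *m h)| <=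
  L * enorm h ^+ 3 / 3.
Proof.
have := @second_difference_norm_le _ (fun t => q (z + t *: h))
  (fun t => dot h (gradient q (z + t *: h)))
  (fun t => dot h (hessian q (z + t *: h) *m h)) (L * enorm h ^+ 3).
rewrite scale1r scaleN1r scale0r addr0; apply=> t.
- by apply: is_derive_line; exact: C2_differentiable.
- exact: is_derive_line_gradient.
- have := hessian_lipschitz z (z + t *: h) h h.
  rewrite mulmxBl dotDr -scaleN1r dotZr mulN1r (addrC z) addrK enormZ.
  by move=> /le_trans; apply; apply: eq_ler; ring.
Qed.

Lemma second_difference_sqr_le z h :
  (q (z + h) + q (z - h) - 2 * q z - dot h (hessian q z *m h)) ^+ 2 <=
  L ^+ 2 / 9 * dot h h ^+ 3.
Proof.
have H := second_difference_hessian z h.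
have H0 := le_trans (normr_ge0 _) H.
have -> : L ^+ 2 / 9 * dot h h ^+ 3 = (L * enorm h ^+ 3 / 3) ^+ 2.
  by rewrite -enormE; field.
by apply: le_trans (lerXn2r 2 _ _ H); rewrite ?nnegrE// -normrX ler_norm.
Qed.

End hessian.

(** * Joint moments of the two Gaussian vectors *)

Section gaussian_pair.
Context (R : realType).

Lemma measurable_coord k (i : 'I_k) :
  measurable_fun setT (fun z : borel_cV R k => z i 0 : R).
Proof.
move=> mD; apply: (measurability _ (RGenOInfty.measurableE R)) => //.
move=> _ [_ [x ->] <-]; rewrite setTI; apply: sub_sigma_algebra.
apply: open_comp => //.
by move=> z _; exact: coord_continuous.
Qed.

Context d (T : measurableType d) (P : probability T R).

Lemma measurable_coordinate k (u : {RV P >-> borel_cV R k}) i :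
  measurable_fun setT (coordinate u i).
Proof.
by apply: (measurableT_comp (measurable_coord i)); exact: measurable_funP.
Qed.

Definition coordinate_mfun k (u : {RV P >-> borel_cV R k}) i : {mfun T >-> R} :=
  let mixin := isMeasurableFun.Build _ _ _ _ _ (measurable_coordinate u i) in
  HB.pack (coordinate u i) mixin.

Variables (n m : nat) (u : {RV P >-> borel_cV R n}) (v : {RV P >-> borel_cV R m}).
Hypotheses (hu : standard_gaussian u) (hv : standard_gaussian v).
Hypothesis huv : independent_pair P u v.

Definition joint_mfun (k : 'I_n + 'I_m) : {mfun T >-> R} :=
  match k with inl i => coordinate_mfun u i | inr j => coordinate_mfun v j end.

Lemma joint_mfunE k w : joint_mfun k w = joint u v k w.
Proof. by case: k. Qed.

Lemma box_measurable k (B : 'I_k -> set R) : (forall i, measurable (B i)) ->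
  measurable ([set z : 'cV[R]_k | forall i, B i (z i 0)] : set (borel_cV R k)).
Proof.
move=> mB.
have -> : [set z : 'cV[R]_k | forall i, B i (z i 0)] =
    \bigcap_(i in [set: 'I_k]) ((fun z : borel_cV R k => z i 0 : R) @^-1` B i).
  by apply/seteqP; split=> z /= H i; [move=> _; exact: H|exact: H].
apply: fin_bigcap_measurable => // i _.
by rewrite -[_ @^-1` _]setTI; apply: measurable_coord.
Qed.

Lemma prob_box k (z : {RV P >-> borel_cV R k}) (B : 'I_k -> set R) :
  standard_gaussian z -> (forall i, measurable (B i)) ->
  P (z @^-1` [set x : 'cV[R]_k | forall i, B i (x i 0)]) =
  (\prod_i P (coordinate_mfun z i @^-1` B i))%E.
Proof.
move=> [ind _] mB; have := ind (finset.setTfor 'I_k) B (fun i _ => mB i).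
have -> : \bigcap_(i in [set` finset.setTfor 'I_k]) (coordinate z i @^-1` B i) =
    z @^-1` [set x : 'cV[R]_k | forall i, B i (x i 0)].
  apply/seteqP; split=> w /= H i; last by move=> _; exact: H.
  by apply: H; rewrite /= inE.
by move=> ->; apply: eq_bigl => i; rewrite inE.
Qed.

(** Independence of the two vectors, applied to two boxes, followed by independence
    of the entries of each vector. *)
Lemma joint_indep (B : 'I_n + 'I_m -> set R) : (forall i, measurable (B i)) ->
  P (\bigcap_(i in setT) (joint_mfun i @^-1` B i)) =
  (\prod_i P (joint_mfun i @^-1` B i))%E.
Proof.
move=> mB; rewrite big_sumType /=.
rewrite -(prob_box hu (fun i => mB (inl i))) -(prob_box hv (fun j => mB (inr j))).
rewrite -huv; last 2 first.
- exact: (box_measurable (fun i => mB (inl i))).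
- exact: (box_measurable (fun j => mB (inr j))).
congr (P _); apply/seteqP; split=> w /=.
  by move=> H; split=> i; [exact: (H (inl i))|exact: (H (inr i))].
by move=> [H1 H2] [i|j] _; [exact: H1|exact: H2].
Qed.

Lemma joint_moments (a : 'I_n + 'I_m -> nat) :
  integ P (monomial (joint u v) a) /\
  mean P (monomial (joint u v) a) = \prod_i normal_moment (a i).
Proof.
have law i (B : set R) : measurable B ->
    P (joint_mfun i @^-1` B) = normal_prob 0 1 B.
  by case: i => [i|j] mB; [exact: hu.2|exact: hv.2].
have := gaussian_monomial joint_indep law a.
rewrite (_ : (fun w => _) = monomial (joint u v) a)//.
by apply/funext => w; apply: eq_bigr => i _; rewrite joint_mfunE.
Qed.

End gaussian_pair.

(** * Comparison with a polynomial majorant *)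

Section expectation_bound.
Context d (T : measurableType d) (R : realType).
Import HBNNSimple.

(** The integral of a nonnegative function is a supremum over the simple functions
    below it, hence monotone on all functions, measurable or not; the smaller
    function will involve [q] composed with the pair (u, v). *)
Lemma ge0_le_integral_pointwise (mu : {measure set T -> \bar R}) (f g : T -> \bar R) :
  (forall x, 0 <= f x)%E -> (forall x, f x <= g x)%E ->
  (\int[mu]_x f x <= \int[mu]_x g x)%E.
Proof.
move=> f0 fg; have g0 x : (0 <= g x)%E by apply: le_trans (fg x).
rewrite !ge0_integralTE//; apply: ereal_sup_le => _ [h hf <-].
by exists h => // x; apply: le_trans (fg x); exact: hf.
Qed.

Lemma expectation_le_mean (P : probability T R) (f g : T -> R) :
  (forall w, 0 <= f w) -> (forall w, f w <= g w) -> integ P g ->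
  ('E_P[f] <= (mean P g)%:E)%E.
Proof.
move=> f0 fg ig; rewrite unlock -mean_EFin//.
by apply: ge0_le_integral_pointwise => w; rewrite lee_fin.
Qed.

End expectation_bound.

(** * Pointwise bound on the second difference *)

Section pointwise.
Context {R : realType} (n m : nat).

Lemma dot_col_mx (a c : 'cV[R]_n) (b e : 'cV[R]_m) :
  dot (col_mx a b) (col_mx c e) = dot a c + dot b e.
Proof.
rewrite /dot big_split_ord; congr (_ + _); apply: eq_bigr => i _.
  by rewrite !col_mxEu.
by rewrite !col_mxEd.
Qed.

(** Cauchy-Schwarz with weights 1/6, 1/3, 1/6, 1/3. *)
Lemma weighted_sqr_sum4 (a b c e : R) :
  (a + b + c + e) ^+ 2 <= 6 * a ^+ 2 + 3 * b ^+ 2 + 6 * c ^+ 2 + 3 * e ^+ 2.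
Proof.
rewrite -subr_ge0.
have -> : 6 * a ^+ 2 + 3 * b ^+ 2 + 6 * c ^+ 2 + 3 * e ^+ 2 - (a + b + c + e) ^+ 2 =
  (a - c) ^+ 2 + (b - e) ^+ 2 + ((2 * a - b) ^+ 2 + (2 * a - e) ^+ 2 +
  (b - 2 * c) ^+ 2 + (2 * c - e) ^+ 2) / 2 by field.
by rewrite !addr_ge0 ?sqr_ge0// divr_ge0// !addr_ge0 ?sqr_ge0.
Qed.

Lemma cube_sum_le (a b : R) : 0 <= a -> 0 <= b ->
  (a + b) ^+ 3 <= 4 * (a ^+ 3 + b ^+ 3).
Proof.
move=> a0 b0; rewrite -subr_ge0.
have -> : 4 * (a ^+ 3 + b ^+ 3) - (a + b) ^+ 3 = 3 * ((a + b) * (a - b) ^+ 2).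
  by ring.
by rewrite mulr_ge0// mulr_ge0 ?sqr_ge0// addr_ge0.
Qed.

Variables (q : 'cV[R]_(n + m) -> R) (L : R).
Hypothesis hq : C2_lipschitz [set: 'cV[R]_(n + m)] L q.
Variables (x : 'cV[R]_n) (y : 'cV[R]_m).

Lemma hessian_xx_sym : (hessian_xx q x y)^T = hessian_xx q x y.
Proof. by rewrite /hessian_xx trmx_ulsub (hessian_sym hq). Qed.

Lemma hessian_yy_sym : (hessian_yy q x y)^T = hessian_yy q x y.
Proof. by rewrite /hessian_yy trmx_drsub (hessian_sym hq). Qed.

Lemma hessian_blockE : hessian q (col_mx x y) =
  block_mx (hessian_xx q x y) (hessian_xy q x y)
           (hessian_xy q x y)^T (hessian_yy q x y).
Proof.
rewrite -[LHS]submxK /hessian_xx /hessian_xy /hessian_yy trmx_ursub.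
by rewrite (hessian_sym hq).
Qed.

Lemma sqr_second_difference_le eta mu (u : 'cV[R]_n) (v : 'cV[R]_m) :
  second_difference q eta mu x y u v ^+ 2 <=
  6 * eta ^+ 4 * dot u (hessian_xx q x y *m u) ^+ 2 +
  12 * eta ^+ 2 * mu ^+ 2 * dot u (hessian_xy q x y *m v) ^+ 2 +
  6 * mu ^+ 4 * dot v (hessian_yy q x y *m v) ^+ 2 +
  4 * L ^+ 2 / 3 * (eta ^+ 6 * dot u u ^+ 3 + mu ^+ 6 * dot v v ^+ 3).
Proof.
have := second_difference_sqr_le hq (col_mx x y) (col_mx (eta *: u) (mu *: v)).
rewrite opp_col_mx !add_col_mx -/(second_difference q eta mu x y u v).
rewrite hessian_blockE mul_block_col !dot_col_mx -!scalemxAr.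
rewrite !dotDr !(dotZl, dotZr).
rewrite [dot v ((hessian_xy q x y)^T *m u)]dot_mulmx trmxK [dot (_ *m v) u]dotC.
set D := second_difference _ _ _ _ _ _ _.
set A := dot u (_ *m u); set B := dot u (_ *m v); set C := dot v (_ *m v).
have := dot_ge0 u; have := dot_ge0 v; move: (dot u u) (dot v v) => r s s0 r0.
set e := D - _ => eL.
have -> : D = eta ^+ 2 * A + 2 * eta * mu * B + mu ^+ 2 * C + e.
  rewrite /e; ring.
apply: (le_trans (weighted_sqr_sum4 _ _ _ _)).
have rs := cube_sum_le (mulr_ge0 (sqr_ge0 eta) r0) (mulr_ge0 (sqr_ge0 mu) s0).
have {}eL : 3 * e ^+ 2 <= 4 * L ^+ 2 / 3 * (eta ^+ 6 * r ^+ 3 + mu ^+ 6 * s ^+ 3).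
  rewrite -ler_pdivlMl//; apply: (le_trans eL).
  rewrite (_ : _ + mu * (mu * s) = eta ^+ 2 * r + mu ^+ 2 * s); last by ring.
  have -> : 3^-1 * (4 * L ^+ 2 / 3 * (eta ^+ 6 * r ^+ 3 + mu ^+ 6 * s ^+ 3)) =
    L ^+ 2 / 9 * (4 * ((eta ^+ 2 * r) ^+ 3 + (mu ^+ 2 * s) ^+ 3)) by field.
  by rewrite ler_wpM2l// divr_ge0// sqr_ge0.
apply: le_trans (lerD (lexx _) eL).
apply: eq_ler; ring.
Qed.

End pointwise.

(** * Squared norm of the stochastic blocks applied to a vector *)

Section weights.
Context {R : realType} (n m : nat).

Lemma enorm_stoch_xx (q : 'cV[R]_(n + m) -> R) eta mu x y u v theta :
  eta != 0 ->
  enorm (stoch_hessian_xx q eta mu x y u v *m theta) ^+ 2 =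
  second_difference q eta mu x y u v ^+ 2 / (4 * eta ^+ 4) *
  dot (dot u theta *: u - theta) (dot u theta *: u - theta).
Proof.
move=> eta0; rewrite enormE /stoch_hessian_xx -scalemxAl mulmxBl mul1mx -mulmxA.
have -> : u *m (u^T *m theta) = dot u theta *: u.
  rewrite dotE; apply/matrixP => i j; rewrite !mxE big_ord1 !ord1 mulrC.
  by congr (_ * _); rewrite !mxE.
rewrite dotZl dotZr mulrA; congr (_ * _); field.
by rewrite eta0.
Qed.

Lemma enorm_stoch_xy (q : 'cV[R]_(n + m) -> R) eta mu x y u v theta :
  eta != 0 -> mu != 0 ->
  enorm (stoch_hessian_xy q eta mu x y u v *m theta) ^+ 2 =
  second_difference q eta mu x y u v ^+ 2 / (eta ^+ 2 * mu ^+ 2) *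
  (dot u u * dot v theta ^+ 2).
Proof.
move=> eta0 mu0; rewrite enormE /stoch_hessian_xy -scalemxAl -mulmxA.
have -> : u *m (v^T *m theta) = dot v theta *: u.
  rewrite dotE; apply/matrixP => i j; rewrite !mxE big_ord1 !ord1 mulrC.
  by congr (_ * _); rewrite !mxE.
rewrite !dotZl !dotZr; field.
by rewrite eta0 mu0.
Qed.

End weights.

(** * Upper bounds on expectations *)

Section mean_le.
Context d (T : measurableType d) (R : realType) (P : probability T R).
Implicit Types F G : T -> R.

(** Integrability travels with the bound, so that bounds can be added. *)
Definition mean_le F b := integ P F /\ mean P F <= b.

Lemma mean_leD F G b c : mean_le F b -> mean_le G c ->
  mean_le (fun w => F w + G w) (b + c).
Proof.
by move=> [iF Fb] [iG Gc]; split; [exact: integD|rewrite meanD// lerD].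
Qed.

Lemma mean_leZ k F b : 0 <= k -> mean_le F b -> mean_le (fun w => k * F w) (k * b).
Proof.
by move=> k0 [iF Fb]; split; [exact: integZ|rewrite meanZ// ler_wpM2l].
Qed.

Lemma mean_le_eq F G b c : mean_le F b -> F =1 G -> b <= c -> mean_le G c.
Proof. by move=> [iF Fb] /funext <- bc; split=> //; exact: le_trans bc. Qed.

Lemma expectation_le (F G : T -> R) b : (forall w, 0 <= F w) ->
  (forall w, F w <= G w) -> mean_le G b -> ('E_P[F] <= b%:E)%E.
Proof.
move=> F0 FG [iG Gb]; apply: (le_trans (expectation_le_mean F0 FG iG)).
by rewrite lee_fin.
Qed.

End mean_le.

(** * Moments against the weights of the two blocks *)

Section weighted_moments.
Context d (T : measurableType d) (R : realType) (P : probability T R).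
Context n m (u : T -> 'cV[R]_n) (v : T -> 'cV[R]_m).
Hypotheses (Su : stein_identity P u v) (Sv : stein_identity P v u).
Local Notation E := (mean P).
Local Notation nn := (n%:R : R).
Local Notation mm := (m%:R : R).
Local Notation r := (fun w => dot (u w) (u w)).
Local Notation rv := (fun w => dot (v w) (v w)).
Local Notation q A := (fun w => dot (u w) (A *m u w)).
Local Notation p B := (fun w => dot (u w) (B *m v w)).
Local Notation qv C := (fun w => dot (v w) (C *m v w)).

Section identity_weight.
Variable theta : 'cV[R]_n.
Local Notation s := (fun w => dot theta (u w)).
Local Notation N := (dot theta theta).
Let W w := dot (dot (u w) theta *: u w - theta) (dot (u w) theta *: u w - theta).

Lemma identity_weightE w : W w = s w ^+ 2 * r w - 2 * s w ^+ 2 + N.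
Proof.
rewrite /W -scaleN1r !dotDl !dotDr !dotZl !dotZr (dotC (u w) theta); ring.
Qed.

(** Since |u|^2 (u . theta)^2 F has the mean of (n + 2 + k) (u . theta)^2 F, the
    term - 2 (u . theta)^2 F of the weight lowers the factor to n + k. *)
Lemma mean_identity_weight k l F g h : bihom u v k l F g h ->
  integ P (fun w => F w * W w) /\
  E (fun w => F w * W w) = (nn + k%:R) * E (fun w => s w * (s w * F w)) + N * E F.
Proof.
move=> bF; have bs := bihom_dotl u v theta; have br := bihom_sqnorm u v.
have bssF := bihomM bs (bihomM bs bF); have brssF := bihomM br bssF.
have iF := bihom_integ Su bF; have iF2 := bihom_integ Su bssF.
have iF3 := bihom_integ Su brssF.
have -> : (fun w => F w * W w) = (fun w => r w * (s w * (s w * F w)) +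
    ((- 2) * (s w * (s w * F w)) + N * F w)).
  apply/funext => w; rewrite identity_weightE; ring.
have i1 := integZ (-2) iF2; have i2 := integZ N iF.
split; first by do 2?[apply: integD => //].
rewrite meanD//; last exact: integD.
rewrite meanD// !meanZ// (mean_sqnorm Su bssF) !natrD; ring.
Qed.

Lemma mean_quad_sqr_identity (A : 'M[R]_n) : A^T = A ->
  mean_le P (fun w => q A w ^+ 2 * W w)
    (((nn + 4) * (3 * nn + 12) + (nn + 2)) * sqfrob A * N).
Proof.
move=> sA; have bq := bihom_quad u v sA.
have [i e] := mean_identity_weight (bihomM bq bq).
apply: (@mean_le_eq _ _ _ _ _ _ _ _ (conj i (lexx _))) => [w|]; first by rewrite expr2.
rewrite e; apply: (le_trans (lerD (ler_wpM2l _ (mean_lin2_quad_sqr_le Su theta sA))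
  (ler_wpM2l (dot_ge0 theta) (mean_quad_sqr_le Su sA)))).
  by rewrite addr_ge0.
by rewrite natrD; apply: eq_ler; ring.
Qed.

Lemma mean_bilinear_sqr_identity (B : 'M[R]_(n, m)) :
  mean_le P (fun w => p B w ^+ 2 * W w) ((3 * nn + 7) * sqfrob B * N).
Proof.
have bp := bihom_bilinear u v B.
have [i e] := mean_identity_weight (bihomM bp bp).
apply: (@mean_le_eq _ _ _ _ _ _ _ _ (conj i (lexx _))) => [w|]; first by rewrite expr2.
rewrite e (mean_bilinear_sqr Su Sv).
apply: (le_trans (lerD (ler_wpM2l _ (mean_lin2_bilinear_sqr_le Su Sv theta B)) (lexx _))).
  by rewrite addr_ge0.
by rewrite natrD; apply: eq_ler; ring.
Qed.

Lemma mean_identity_weight_const l F h : bihom u v 0 l F (fun=> 0) h ->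
  integ P (fun w => F w * W w) /\ E (fun w => F w * W w) = (nn + 1) * N * E F.
Proof.
move=> bF; have [i e] := mean_identity_weight bF; split=> //.
rewrite e (mean_lin2 Su theta bF)//; ring.
Qed.

Lemma bihom_zero_grad l F g h : bihom u v 0 l F g h -> g =1 (fun=> 0) ->
  bihom u v 0 l F (fun=> 0) h.
Proof. by move=> bF g0; apply: bihom_eq bF _ g0 _. Qed.

Lemma mean_quadr_sqr_identity (C : 'M[R]_m) : C^T = C ->
  mean_le P (fun w => qv C w ^+ 2 * W w) ((nn + 1) * (mm + 2) * sqfrob C * N).
Proof.
move=> sC; have bq := bihom_swap (bihom_quad v u sC).
have [|i e] := mean_identity_weight_const (bihom_zero_grad (bihomM bq bq) _).
  by move=> w; rewrite !scaler0 addr0.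
apply: (@mean_le_eq _ _ _ _ _ _ _ _ (conj i (lexx _))) => [w|]; first by rewrite expr2.
rewrite e; apply: (le_trans (ler_wpM2l _ (mean_quad_sqr_le Sv sC))).
  by rewrite mulr_ge0 ?dot_ge0// addr_ge0.
by apply: eq_ler; ring.
Qed.

Lemma mean_sqnorm_cube_identity :
  mean_le P (fun w => r w ^+ 3 * W w)
    (((nn + 6) ^+ 2 * (nn + 4) * (nn + 2) + nn * (nn + 2) * (nn + 4)) * N).
Proof.
have br := bihom_sqnorm u v; have bs := bihom_dotl u v theta.
have [i e] := mean_identity_weight (bihomM br (bihomM br br)).
apply: (@mean_le_eq _ _ _ _ _ _ _ _ (conj i (lexx _))) => [w|].
  by rewrite !exprS expr0 mulr1.
rewrite e (mean_sqnorm_cube Su).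
rewrite (@eq_mean _ _ _ P _ (fun w => r w * (r w * (r w * (s w * s w))))); last first.
  move=> w /=; ring.
rewrite (mean_sqnorm_cube_mul Su (bihomM bs bs)) (mean_lin_lin Su) !natrD.
by apply: eq_ler; ring.
Qed.

Lemma mean_sqnormr_cube_identity :
  mean_le P (fun w => rv w ^+ 3 * W w)
    ((nn + 1) * ((mm + 4) * ((mm + 2) * mm)) * N).
Proof.
have br := bihom_swap (bihom_sqnorm v u).
have [|i e] := mean_identity_weight_const (bihom_zero_grad (bihomM br (bihomM br br)) _).
  by move=> w; rewrite !(scaler0, addr0).
apply: (@mean_le_eq _ _ _ _ _ _ _ _ (conj i (lexx _))) => [w|].
  by rewrite !exprS expr0 mulr1.
rewrite e (mean_sqnorm_cube Sv).
by apply: eq_ler; ring.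
Qed.

End identity_weight.

Section outer_weight.
Variable theta : 'cV[R]_m.
Local Notation t := (fun w => dot theta (v w)).
Local Notation N := (dot theta theta).
Let W w := dot (u w) (u w) * dot (v w) theta ^+ 2.

(** The factor |u|^2 is removed by [mean_sqnorm]; the weight in [v] does not raise
    the degree in [u]. *)
Lemma mean_outer_weight k l F g h : bihom u v k l F g h ->
  integ P (fun w => F w * W w) /\
  E (fun w => F w * W w) = (nn + k%:R) * E (fun w => t w * (t w * F w)).
Proof.
move=> bF; have bt := bihom_dotr u v theta.
have bttF := bihomM bt (bihomM bt bF).
have -> : (fun w => F w * W w) = (fun w => r w * (t w * (t w * F w))).
  by apply/funext => w; rewrite /W (dotC (v w)); ring.
split; first exact: (bihom_integ Su (bihomM (bihom_sqnorm u v) bttF)).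
by rewrite (mean_sqnorm Su bttF) !natrD; congr (_ * _); ring.
Qed.

Lemma mean_quad_sqr_outer (A : 'M[R]_n) : A^T = A ->
  mean_le P (fun w => q A w ^+ 2 * W w) ((nn + 4) * (nn + 2) * sqfrob A * N).
Proof.
move=> sA; have bq := bihom_quad u v sA; have bqq := bihomM bq bq.
have [i e] := mean_outer_weight bqq.
apply: (@mean_le_eq _ _ _ _ _ _ _ _ (conj i (lexx _))) => [w|]; first by rewrite expr2.
rewrite e (mean_lin2 Sv theta (bihom_swap bqq)); last first.
  by move=> w; rewrite !scaler0 addr0.
apply: (le_trans (ler_wpM2l _ (ler_wpM2l (dot_ge0 _) (mean_quad_sqr_le Su sA)))).
  by rewrite addr_ge0.
by rewrite natrD; apply: eq_ler; ring.
Qed.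

Lemma mean_bilinear_sqr_outer (B : 'M[R]_(n, m)) :
  mean_le P (fun w => p B w ^+ 2 * W w) (3 * (nn + 2) * sqfrob B * N).
Proof.
have bp := bihom_bilinear u v B; have [i e] := mean_outer_weight (bihomM bp bp).
apply: (@mean_le_eq _ _ _ _ _ _ _ _ (conj i (lexx _))) => [w|]; first by rewrite expr2.
have pT w : p B w = dot (v w) (B^T *m u w) by rewrite [RHS]dot_mulmx trmxK dotC.
rewrite e; under eq_fun do rewrite pT.
apply: (le_trans (ler_wpM2l _ (mean_lin2_bilinear_sqr_le Sv Su theta B^T))).
  by rewrite addr_ge0.
by rewrite sqfrob_tr natrD; apply: eq_ler; ring.
Qed.

Lemma mean_quadr_sqr_outer (C : 'M[R]_m) : C^T = C ->
  mean_le P (fun w => qv C w ^+ 2 * W w) (nn * (3 * mm + 12) * sqfrob C * N).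
Proof.
move=> sC; have bq := bihom_swap (bihom_quad v u sC).
have [i e] := mean_outer_weight (bihomM bq bq).
apply: (@mean_le_eq _ _ _ _ _ _ _ _ (conj i (lexx _))) => [w|]; first by rewrite expr2.
rewrite e; apply: (le_trans (ler_wpM2l _ (mean_lin2_quad_sqr_le Sv theta sC))).
  by rewrite addr_ge0.
by rewrite natrD; apply: eq_ler; ring.
Qed.

Lemma mean_sqnorm_cube_outer :
  mean_le P (fun w => r w ^+ 3 * W w)
    ((nn + 6) * ((nn + 4) * ((nn + 2) * nn)) * N).
Proof.
have br := bihom_sqnorm u v; have brrr := bihomM br (bihomM br br).
have [i e] := mean_outer_weight brrr.
apply: (@mean_le_eq _ _ _ _ _ _ _ _ (conj i (lexx _))) => [w|].
  by rewrite !exprS expr0 mulr1.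
rewrite e (mean_lin2 Sv theta (bihom_swap brrr)) ?(mean_sqnorm_cube Su); last first.
  by move=> w; rewrite !(scaler0, addr0).
by rewrite !natrD; apply: eq_ler; ring.
Qed.

Lemma mean_sqnormr_cube_outer :
  mean_le P (fun w => rv w ^+ 3 * W w)
    (nn * ((mm + 6) * ((mm + 4) * (mm + 2))) * N).
Proof.
have br := bihom_swap (bihom_sqnorm v u); have bt := bihom_dotl v u theta.
have [i e] := mean_outer_weight (bihomM br (bihomM br br)).
apply: (@mean_le_eq _ _ _ _ _ _ _ _ (conj i (lexx _))) => [w|].
  by rewrite !exprS expr0 mulr1.
rewrite e.
rewrite (@eq_mean _ _ _ P _ (fun w => rv w * (rv w * (rv w * (t w * t w)))));
  last first.
  move=> w /=; ring.
rewrite (mean_sqnorm_cube_mul Sv (bihomM bt bt)) (mean_lin_lin Sv) !natrD.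
by apply: eq_ler; ring.
Qed.

End outer_weight.

End weighted_moments.

(** * The two bounds *)

Lemma poly_bound_quad (R : realType) (n : R) : 0 <= n ->
  (n + 4) * (3 * n + 12) + (n + 2) <= 5 * (n + 6) ^+ 2.
Proof. by move=> n0; nra. Qed.

Lemma poly_bound_sqnorm (R : realType) (n : R) : 0 <= n ->
  (n + 6) ^+ 2 * (n + 4) * (n + 2) + n * (n + 2) * (n + 4) <= 12 * (n + 16) ^+ 4.
Proof.
move=> n0.
have H1 : (n + 6) ^+ 2 * (n + 4) * (n + 2) <= (n + 16) ^+ 4.
  have -> : (n + 16) ^+ 4 = (n + 16) * (n + 16) * (n + 16) * (n + 16) by ring.
  rewrite expr2.
  by rewrite !ler_pM ?mulr_ge0 ?addr_ge0//; lra.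
have H2 : n * (n + 2) * (n + 4) <= (n + 16) ^+ 4.
  apply: (@le_trans _ _ ((n + 16) ^+ 3)); last first.
    by rewrite ler_weXn2l//; lra.
  rewrite (_ : (n + 16) ^+ 3 = (n + 16) * (n + 16) * (n + 16)); last by ring.
  by rewrite !ler_pM ?mulr_ge0 ?addr_ge0//; lra.
have H3 : 0 <= (n + 16) ^+ 4 by rewrite exprn_ge0 ?addr_ge0.
lra.
Qed.

Lemma poly_bound_sqnormr (R : realType) (m : R) : 0 <= m ->
  (m + 4) * ((m + 2) * m) <= 2 * (m + 6) ^+ 3.
Proof.
move=> m0.
have H : (m + 4) * ((m + 2) * m) <= (m + 6) ^+ 3.
  rewrite (_ : (m + 6) ^+ 3 = (m + 6) * ((m + 6) * (m + 6))); last by ring.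
  by rewrite !ler_pM ?mulr_ge0 ?addr_ge0//; lra.
have H3 : 0 <= (m + 6) ^+ 3 by rewrite exprn_ge0 ?addr_ge0.
lra.
Qed.

Lemma poly_bound_sqnorm_outer (R : realType) (n : R) : 0 <= n ->
  (n + 6) * ((n + 4) * ((n + 2) * n)) <= 6 * (n + 8) ^+ 4.
Proof.
move=> n0.
have H : (n + 6) * ((n + 4) * ((n + 2) * n)) <= (n + 8) ^+ 4.
  rewrite (_ : (n + 8) ^+ 4 = (n + 8) * ((n + 8) * ((n + 8) * (n + 8)))); last by ring.
  by rewrite !ler_pM ?mulr_ge0 ?addr_ge0//; lra.
have H3 : 0 <= (n + 8) ^+ 4 by rewrite exprn_ge0 ?addr_ge0.
lra.
Qed.

Lemma poly_bound_sqnormr_outer (R : realType) (m : R) : 0 <= m ->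
  (m + 6) * ((m + 4) * (m + 2)) <= 12 * (m + 12) ^+ 3.
Proof.
move=> m0.
have H : (m + 6) * ((m + 4) * (m + 2)) <= (m + 12) ^+ 3.
  rewrite (_ : (m + 12) ^+ 3 = (m + 12) * ((m + 12) * (m + 12))); last by ring.
  by rewrite !ler_pM ?mulr_ge0 ?addr_ge0//; lra.
have H3 : 0 <= (m + 12) ^+ 3 by rewrite exprn_ge0 ?addr_ge0.
lra.
Qed.

Theorem proposition2p5 (R : realType) (n m : nat) (hn : (1 <= n)%N)
    (hm : (1 <= m)%N) (q : 'cV[R]_(n + m) -> R) (L : R)
    (hq : C2_lipschitz [set: 'cV[R]_(n + m)] L q)
    (x : 'cV[R]_n) (y : 'cV[R]_m) (eta mu : R) (heta : 0 < eta) (hmu : 0 < mu)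
    (d : measure_display) (T : measurableType d) (P : probability T R)
    (u : {RV P >-> borel_cV R n}) (v : {RV P >-> borel_cV R m})
    (hu : standard_gaussian u) (hv : standard_gaussian v)
    (huv : independent_pair P u v) :
  (forall theta : 'cV[R]_n,
    ('E_P[(fun w =>
        enorm (stoch_hessian_xx q eta mu x y (u w) (v w) *m theta) ^+ 2)%R]
     <= (2 * L ^+ 2 *
           (2 * eta ^+ 2 * (n%:R + 16) ^+ 4
            + mu ^+ 6 / eta ^+ 4 * (m%:R + 6) ^+ 3 * (n%:R + 3))
           * enorm theta ^+ 2
         + (15 / 2 * (n%:R + 6) ^+ 2 * frobenius_norm (hessian_xx q x y) ^+ 2
            + 3 * mu ^+ 2 / eta ^+ 2 * (3 * n%:R + 13)
              * frobenius_norm (hessian_xy q x y) ^+ 2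
            + 3 * mu ^+ 4 / (2 * eta ^+ 4) * (m%:R + 2) * (n%:R + 3)
              * frobenius_norm (hessian_yy q x y) ^+ 2)
           * enorm theta ^+ 2)%:E)%E)
  /\
  (forall theta : 'cV[R]_m,
    ('E_P[(fun w =>
        enorm (stoch_hessian_xy q eta mu x y (u w) (v w) *m theta) ^+ 2)%R]
     <= (8 * L ^+ 2 *
           (eta ^+ 4 / mu ^+ 2 * (n%:R + 8) ^+ 4
            + 2 * mu ^+ 4 / eta ^+ 2 * n%:R * (m%:R + 12) ^+ 3)
           * enorm theta ^+ 2
         + (6 * eta ^+ 2 / mu ^+ 2 * (n%:R + 4) * (n%:R + 2)
              * frobenius_norm (hessian_xx q x y) ^+ 2
            + 36 * (n%:R + 2) * frobenius_norm (hessian_xy q x y) ^+ 2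
            + 30 * mu ^+ 2 / eta ^+ 2 * n%:R * (m%:R + 2)
              * frobenius_norm (hessian_yy q x y) ^+ 2)
           * enorm theta ^+ 2)%:E)%E).
Proof.
have Su : stein_identity P (u : T -> 'cV[R]_n) (v : T -> 'cV[R]_m).
  exact: steinP hn (joint_moments hu hv huv).
have huv' : independent_pair P v u.
  by move=> A B mA mB; rewrite setIC huv// muleC.
have Sv : stein_identity P (v : T -> 'cV[R]_m) (u : T -> 'cV[R]_n).
  exact: steinP hm (joint_moments hv hu huv').
have eta0 : eta != 0 by rewrite gt_eqF.
have mu0 : mu != 0 by rewrite gt_eqF.
have sA := hessian_xx_sym hq x y; have sC := hessian_yy_sym hq x y.
have n0 : 0 <= n%:R :> R by []; have m1 : 1 <= m%:R :> R by rewrite ler1n.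
have m0 : 0 <= m%:R :> R by [].
have L0 := sqr_ge0 L; have L40 : 0 <= 4 * L ^+ 2 by rewrite mulr_ge0.
have eta_ge0 := ltW heta; have mu_ge0 := ltW hmu.
have etak k := exprn_ge0 k (ltW heta); have muk k := exprn_ge0 k (ltW hmu).
pose D w := second_difference q eta mu x y (u w) (v w).
have D2 w := sqr_second_difference_le hq x y eta mu (u w) (v w).
split=> theta; rewrite !sqfrobE !enormE; have N0 := dot_ge0 theta.
(* c1, ..., c5 are the coefficients of [sqr_second_difference_le] divided by
   [4 * eta ^+ 4], and by [eta ^+ 2 * mu ^+ 2] in the second part *)
- pose c1 : R := 3 / 2.
  pose c2 := 3 * mu ^+ 2 / eta ^+ 2.
  pose c3 := 3 * mu ^+ 4 / (2 * eta ^+ 4).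
  pose c4 := L ^+ 2 * eta ^+ 2 / 3.
  pose c5 := L ^+ 2 * mu ^+ 6 / (3 * eta ^+ 4).
  have c10 : 0 <= c1 by rewrite divr_ge0 ?mulr_ge0 ?mulr_ge0 ?etak ?muk.
  have c20 : 0 <= c2 by rewrite divr_ge0 ?mulr_ge0 ?mulr_ge0 ?etak ?muk.
  have c30 : 0 <= c3 by rewrite divr_ge0 ?mulr_ge0 ?mulr_ge0 ?etak ?muk.
  have c40 : 0 <= c4.
    by rewrite divr_ge0 ?(mulr_ge0 L0) ?etak ?muk ?mulr_ge0 ?etak ?muk.
  have c50 : 0 <= c5.
    by rewrite divr_ge0 ?(mulr_ge0 L0) ?etak ?muk ?mulr_ge0 ?etak ?muk.
  have K := mean_leD (mean_leZ c10 (mean_quad_sqr_identity Su theta sA))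
    (mean_leD (mean_leZ c20 (mean_bilinear_sqr_identity Su Sv theta (hessian_xy q x y)))
    (mean_leD (mean_leZ c30 (mean_quadr_sqr_identity Su Sv theta sC))
    (mean_leD (mean_leZ c40 (mean_sqnorm_cube_identity Su theta))
      (mean_leZ c50 (mean_sqnormr_cube_identity Su Sv theta))))).
  apply: (expectation_le _ _ (mean_le_eq K (frefl _) _)) => [w|w|].
  + exact: sqr_ge0.
  + rewrite enorm_stoch_xx//.
    have W0 := dot_ge0 (dot (u w) theta *: u w - theta).
    have e0 : 0 <= (4 * eta ^+ 4)^-1 by rewrite invr_ge0 mulr_ge0// exprn_ge0// ltW.
    apply: (le_trans (ler_wpM2r W0 (ler_wpM2r e0 (D2 w)))).
    apply: eq_ler.
    rewrite /c1 /c2 /c3 /c4 /c5; field.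
    by rewrite eta0.
  + set fA := sqfrob _; set fB := sqfrob _; set fC := sqfrob _.
    have fA0 : 0 <= fA by exact: sqfrob_ge0.
    have fB0 : 0 <= fB by exact: sqfrob_ge0.
    have fC0 : 0 <= fC by exact: sqfrob_ge0.
    set N := dot theta theta; rewrite -/N in N0.
    set nn := n%:R; rewrite -/nn in n0; set mm := m%:R; rewrite -/mm in m0.
    rewrite [leRHS](_ : _ = c1 * (5 * (nn + 6) ^+ 2 * fA * N) +
      (c2 * ((3 * nn + 13) * fB * N) + (c3 * ((nn + 3) * (mm + 2) * fC * N) +
      (c4 * (12 * (nn + 16) ^+ 4 * N) +
       c5 * ((nn + 3) * (2 * (mm + 6) ^+ 3) * 3 * N))))); last first.
      by rewrite /c1 /c2 /c3 /c4 /c5; field; rewrite eta0.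
    rewrite !lerD// ler_wpM2l// ler_wpM2r//.
    * by rewrite ler_wpM2r// poly_bound_quad.
    * by rewrite ler_wpM2r// lerD2l ler_nat.
    * by rewrite ler_wpM2r// ler_wpM2r ?addr_ge0//; lra.
    * exact: poly_bound_sqnorm.
    * have m6 : 0 <= (nn + 3) * (2 * (mm + 6) ^+ 3).
        by rewrite !(mulr_ge0, exprn_ge0, addr_ge0).
      apply: (@le_trans _ _ ((nn + 3) * (2 * (mm + 6) ^+ 3))); last by lra.
      rewrite ler_pM ?poly_bound_sqnormr// ?mulr_ge0 ?addr_ge0//; lra.
- pose c1 := 6 * eta ^+ 2 / mu ^+ 2.
  pose c2 : R := 12.
  pose c3 := 6 * mu ^+ 2 / eta ^+ 2.
  pose c4 := 4 * L ^+ 2 * eta ^+ 4 / (3 * mu ^+ 2).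
  pose c5 := 4 * L ^+ 2 * mu ^+ 4 / (3 * eta ^+ 2).
  have c10 : 0 <= c1 by rewrite divr_ge0 ?mulr_ge0 ?mulr_ge0 ?etak ?muk.
  have c20 : 0 <= c2 by [].
  have c30 : 0 <= c3 by rewrite divr_ge0 ?mulr_ge0 ?mulr_ge0 ?etak ?muk.
  have c40 : 0 <= c4.
    by rewrite divr_ge0 ?(mulr_ge0 L40) ?etak ?muk ?mulr_ge0 ?etak ?muk.
  have c50 : 0 <= c5.
    by rewrite divr_ge0 ?(mulr_ge0 L40) ?etak ?muk ?mulr_ge0 ?etak ?muk.
  have K := mean_leD (mean_leZ c10 (mean_quad_sqr_outer Su Sv theta sA))
    (mean_leD (mean_leZ c20 (mean_bilinear_sqr_outer Su Sv theta (hessian_xy q x y)))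
    (mean_leD (mean_leZ c30 (mean_quadr_sqr_outer Su Sv theta sC))
    (mean_leD (mean_leZ c40 (mean_sqnorm_cube_outer Su Sv theta))
      (mean_leZ c50 (mean_sqnormr_cube_outer Su Sv theta))))).
  apply: (expectation_le _ _ (mean_le_eq K (frefl _) _)) => [w|w|].
  + exact: sqr_ge0.
  + rewrite enorm_stoch_xy//.
    have W0 : 0 <= dot (u w) (u w) * dot (v w) theta ^+ 2.
      by rewrite mulr_ge0 ?dot_ge0 ?sqr_ge0.
    have e0 : 0 <= (eta ^+ 2 * mu ^+ 2)^-1 by rewrite invr_ge0 mulr_ge0 ?sqr_ge0.
    apply: (le_trans (ler_wpM2r W0 (ler_wpM2r e0 (D2 w)))).
    apply: eq_ler.
    rewrite /c1 /c2 /c3 /c4 /c5; field.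
    by rewrite eta0.
  + set fA := sqfrob _; set fB := sqfrob _; set fC := sqfrob _.
    have fA0 : 0 <= fA by exact: sqfrob_ge0.
    have fB0 : 0 <= fB by exact: sqfrob_ge0.
    have fC0 : 0 <= fC by exact: sqfrob_ge0.
    set N := dot theta theta; rewrite -/N in N0.
    set nn := n%:R; rewrite -/nn in n0; set mm := m%:R; rewrite -/mm in m0 m1.
    rewrite [leRHS](_ : _ = c1 * ((nn + 4) * (nn + 2) * fA * N) +
      (c2 * (3 * (nn + 2) * fB * N) + (c3 * (nn * (5 * mm + 10) * fC * N) +
      (c4 * (6 * (nn + 8) ^+ 4 * N) + c5 * (nn * (12 * (mm + 12) ^+ 3) * N)))));
      last first.
      by rewrite /c1 /c2 /c3 /c4 /c5; field; rewrite eta0.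
    rewrite !lerD// ler_wpM2l// ler_wpM2r//.
    (* 3 m + 12 <= 5 m + 10 is where the hypothesis 1 <= m enters *)
    * by rewrite ler_wpM2r// ler_wpM2l//; lra.
    * exact: poly_bound_sqnorm_outer.
    * by rewrite ler_wpM2l// poly_bound_sqnormr_outer.
Qed.
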